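(* Let $\alpha>0$. (1) For all sufficiently small $\delta>0$ (that is, there is $\delta_1>0$ such that for all $\delta\in(0,\delta_1)$) the following holds: if there is $c\in\mathbb R$ such that $$\log \fint_{\mathbb S^2}e^{2u}\,dV\le\alpha\fint_{\mathbb S^2}|\nabla u|^2\,dV+2\fint_{\mathbb S^2}u\,dV+c$$ for all $u\in\mathring{\mathcal M}_1$ with $\|\Lambda(u)\|^2\le\frac23-\delta$, then $\alpha\ge\frac13$. (2) For all sufficiently small $\delta>0$ (in the same sense) the following holds: if there is $c\in\mathbb R$ such that $$\log \fint_{\mathbb S^2}e^{2u}\,dV\le\alpha\fint_{\mathbb S^2}|\nabla u|^2\,dV+2\fint_{\mathbb S^2}u\,dV+c$$ for all $u\in\mathring{\mathcal M}_1$ with $\|\Lambda(u)\|^2\le\frac16-\delta$, then $\alpha\ge\frac14$. (The thresholds $\delta_1$ do not depend on $\alpha$ or $c$.)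
   Context: $\mathbb S^2\subset\mathbb R^3$ is the unit sphere with its standard round metric and area measure $dV$; $x_1,x_2,x_3$ are the coordinate functions of $\mathbb R^3$ restricted to $\mathbb S^2$; $\fint_{\mathbb S^2}f\,dV=\frac1{4\pi}\int_{\mathbb S^2}f\,dV$. Define $$\mathring{\mathcal M}_1=\Big\{u\in H^1(\mathbb S^2):\ \int_{\mathbb S^2}x_ie^{2u}\,dV=0\text{ for }i=1,2,3\Big\}.$$ For $u\in H^1(\mathbb S^2)$ let $\Lambda(u)=(\Lambda_{ij})_{1\le i,j\le3}$ with $$\Lambda_{ij}=\frac{\int_{\mathbb S^2}e^{2u}\left(x_ix_j-\frac13\delta_{ij}\right)dV}{\int_{\mathbb S^2}e^{2u}\,dV},\qquad \|\Lambda\|=\Big(\sum_{i,j=1}^3\Lambda_{ij}^2\Big)^{1/2}.$$ *)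

(* Defs.v *)
From HB Require Import structures.
From mathcomp Require Import all_boot all_order all_algebra.
From mathcomp Require Import all_classical all_reals all_analysis.
From mathcomp Require Import measurable_realfun.

Set Implicit Arguments.
Unset Strict Implicit.
Unset Printing Implicit Defensive.

Import Order.TTheory GRing.Theory Num.Theory.
Import numFieldNormedType.Exports.

Local Open Scope classical_set_scope.
Local Open Scope ring_scope.

(* R^3 is [R * R * R]: this type carries both the Borel sigma-algebra and the
   normed-module structure used by ['D_v f].  Its library norm [`|x|] is the
   max norm, hence the explicit Euclidean [sqnorm]. *)
Notation R3 R := (R * R * R)%type.

Section sphere.
Context {R : realType}.
Implicit Types (x v : R3 R) (f u : R3 R -> R) (G : R3 R -> R3 R) (i j : 'I_3).

Definition coord i x : R :=
  match val i with 0%N => x.1.1 | 1%N => x.1.2 | _ => x.2 end.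

Definition std_basis i : R3 R :=
  ((i == 0%N :> nat)%:R, (i == 1%N :> nat)%:R, (i == 2%N :> nat)%:R).

Definition sqnorm x : R := \sum_(i < 3) coord i x ^+ 2.

Definition S2 : set (R3 R) := [set x | sqnorm x = 1].

Definition sph (p : R * R) : R3 R :=
  (sin p.1 * cos p.2, sin p.1 * sin p.2, cos p.1).

Definition sph_dom : set (R * R) := `[0, pi] `*` `[0, 2 * pi].

(* In the coordinates (theta, phi) the round metric is
   dtheta^2 + sin(theta)^2 dphi^2, so that dV = sin(theta) dtheta dphi. *)
Definition area (A : set (R3 R)) : \bar R :=
  (\int[lebesgue_measure \x lebesgue_measure]_(p in sph_dom `&` sph @^-1` A)
     (sin p.1)%:E)%E.

Lemma measurable_sph : measurable_fun setT sph.
Proof.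
have ms : measurable_fun setT (@sin R).
  by apply: continuous_measurable_fun => x; exact: continuous_sin.
have mc : measurable_fun setT (@cos R).
  by apply: continuous_measurable_fun => x; exact: continuous_cos.
have m1 (g : R -> R) : measurable_fun setT g ->
    measurable_fun setT (fun p : R * R => g p.1).
  by move=> mg; apply: measurableT_comp mg _; exact: measurable_fst.
have m2 (g : R -> R) : measurable_fun setT g ->
    measurable_fun setT (fun p : R * R => g p.2).
  by move=> mg; apply: measurableT_comp mg _; exact: measurable_snd.
apply: measurable_fun_pair => /=; last exact: m1.
by apply: measurable_fun_pair => /=; apply: measurable_funM; auto.
Qed.

Lemma measurable_sph_dom : measurable sph_dom.
Proof. by apply: measurableX; exact: measurable_itv. Qed.

Lemma measurable_sph_preimage (A : set (R3 R)) :
  measurable A -> measurable (sph_dom `&` sph @^-1` A).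
Proof.
move=> mA; apply: measurableI; first exact: measurable_sph_dom.
by rewrite -[X in measurable X]setTI; exact: measurable_sph.
Qed.

Lemma sin_sph_dom_ge0 (p : R * R) : sph_dom p -> (0 <= (sin p.1)%:E)%E.
Proof. by case=> /= h _; rewrite lee_fin sin_ge0_pi. Qed.

Lemma area0 : area set0 = 0%E.
Proof. by rewrite /area preimage_set0 setI0 integral_set0. Qed.

Lemma area_ge0 A : (0 <= area A)%E.
Proof. by apply: integral_ge0 => p [/sin_sph_dom_ge0]. Qed.

Lemma area_sigma_additive : semi_sigma_additive area.
Proof.
move=> F mF tF mUF.
rewrite /area preimage_bigcup setI_bigcupr ge0_integral_bigcup//.
- apply: is_cvg_nneseries => n _ _.
  by apply: integral_ge0 => p [/sin_sph_dom_ge0].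
- by move=> k; exact: measurable_sph_preimage.
- apply: measurable_funTS; apply/measurable_EFinP.
  apply: (@measurableT_comp _ _ _ _ _ _ (@sin R)); last exact: measurable_fst.
  by apply: continuous_measurable_fun => x; exact: continuous_sin.
- by move=> p [k _ [/sin_sph_dom_ge0]].
- apply/trivIsetP => a b _ _ ab.
  move/trivIsetP : tF => /(_ a b Logic.I Logic.I ab) Fab.
  by rewrite setIACA -preimage_setI Fab preimage_set0 setI0.
Qed.

HB.instance Definition _ := isMeasure.Build _ _ _
  area area0 area_ge0 area_sigma_additive.

Definition integral_S2 f : R := \int[area]_(x in S2) f x.

Definition mean_S2 f : R := (4 * pi)^-1 * integral_S2 f.

(* A function on the sphere is given by the values on [S2] of a function on
   R^3.  Its extension to R^3 \ {0}, constant along rays, depends on these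
   values only; the function is smooth on the sphere iff this extension is
   smooth on R^3 \ {0}, and its Riemannian gradient at a point of the sphere,
   seen as a vector of R^3, is the Euclidean gradient of the extension. *)
Definition radial_ext f x : R := f ((Num.sqrt (sqnorm x))^-1 *: x).

Fixpoint class_C (n : nat) (U : set (R3 R)) f : Prop :=
  match n with
  | 0%N => forall x, U x -> {for x, continuous f}
  | n'.+1 => forall i, (forall x, U x -> derivable f x (std_basis i)) /\
                       class_C n' U ('D_(std_basis i) f)
  end.

Definition smooth_S2 f : Prop :=
  forall n, class_C n [set x | x != 0] (radial_ext f).

Definition grad_S2 f x : R3 R :=
  ('D_(std_basis 0) (radial_ext f) x, 'D_(std_basis 1) (radial_ext f) x,
   'D_(std_basis 2) (radial_ext f) x).

(* H^1(S^2) is the completion of the smooth functions for the norm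
   (||u||_{L^2}^2 + ||grad u||_{L^2}^2)^(1/2): u is in H^1 with gradient G when
   (u, G) is an L^2 limit of pairs (phi_n, grad phi_n).  As the phi_n are
   bounded with bounded gradients, u and G are then square integrable.  G is
   determined by u up to null sets. *)
Definition H1_gradient u G : Prop :=
  [/\ measurable_fun S2 u, measurable_fun S2 G &
   exists phi : nat -> R3 R -> R,
   [/\ forall n, smooth_S2 (phi n),
     (\int[area]_(x in S2) ((phi n x - u x) ^+ 2)%:E)%E @[n --> \oo] --> 0%E &
     (\int[area]_(x in S2) (sqnorm (grad_S2 (phi n) x - G x))%:E)%E
       @[n --> \oo] --> 0%E]].

Definition H1 u : Prop := exists G, H1_gradient u G.

Definition M1 : set (R3 R -> R) :=
  [set u | H1 u /\
     forall i, integral_S2 (fun x => coord i x * expR (2 * u x)) = 0].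

Definition Lambda u : 'M[R]_3 :=
  \matrix_(i, j)
    (integral_S2 (fun x => expR (2 * u x) *
                           (coord i x * coord j x - 3^-1 * (i == j)%:R))
     / integral_S2 (fun x => expR (2 * u x))).

Definition frobenius_norm (A : 'M[R]_3) : R :=
  Num.sqrt (\sum_(i < 3) \sum_(j < 3) A i j ^+ 2).

End sphere.

(* Main.v *)
(* Let t = 1 - r^2 with r -> 0 and let a_1, ..., a_N be unit vectors.  The test
   function is u = (1/2) ln (w_1 + ... + w_N), w_k = (1 - t x.a_k)^-2, so that
   the mass e^(2u) concentrates at the a_k.  Since
   int 1/(1 - t x.a) dV = (2 pi/t) ln ((1+t)/(1-t)) and int w_k dV >= C/r^2,
   with l = ln (1/r) one gets ln (mean e^(2u)) >= 2 l - C, while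
   - |grad u|^2 <= sum_k |grad ln (1 - t x.a_k)|^2 <= sum_k 2 t/(1 - t x.a_k) by
     convexity, whence mean |grad u|^2 <= 2 N l + C;
   - u <= ln (sum_k 1/(1 - t x.a_k)), whence mean u = o(l);
   - Lambda(u) tends to (1/N) sum_k a_k a_k^T - I/3, because
     |x - a_k|^2 is at most a multiple of 1 - t x.a_k.
   Hence alpha >= 1/N.  The a_k form an orbit of an isometry of the sphere, which
   makes the barycenter of e^(2u) vanish exactly: an equilateral triangle on the
   equator (N = 3, limit |Lambda|^2 = 1/6 < 2/3), and the four points
   (4/5, 0, 3/5), (0, 4/5, -3/5), (-4/5, 0, 3/5), (0, -4/5, -3/5), close to a
   regular tetrahedron (N = 4, limit |Lambda|^2 = 2/1875 < 1/6). *)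

Require Import Defs.
From HB Require Import structures.
From mathcomp Require Import all_boot all_order all_algebra.
From mathcomp Require Import all_classical all_reals all_analysis.
From mathcomp Require Import measurable_realfun ring lra.

Set Implicit Arguments.
Unset Strict Implicit.
Unset Printing Implicit Defensive.

Import Order.TTheory GRing.Theory Num.Theory.
Import numFieldNormedType.Exports.
Import Defs.

Local Open Scope classical_set_scope.
Local Open Scope ring_scope.

(** * The area measure in spherical coordinates *)

(** The isometries used are those visible in the coordinates (theta, phi): a shift of phi and the
    reflection theta -> pi - theta. Both come down to the invariance of Lebesgue measure on the
    line, and this decides the shape of the rest. Each orbit is generated by a rotation about the
    third axis or by its product with the reflection in the equator, and its base point b = (a1, 0,
    a3) has a1 > 0. Since no isometry among these brings b to a pole, the integral of 1/(1 - t x.b)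
    is computed directly: a Poisson kernel in phi, then a logarithmic primitive in theta. The mass
    only needs a bound from below, for which a small box of angles next to b is enough. A single
    isometry T carries all the centres a_k = T^k b, so that each integral over a bubble reduces to
    the one at b. The regular tetrahedron is itself such an orbit; its neighbour with coordinates
    3/5 and 4/5 has rational moments, and the gap between 2/1875 and 1/6 leaves room for it and for
    crude error constants. *)

Section area_integral.
Context {R : realType}.
Local Notation mu := (@lebesgue_measure R).
Local Notation mu2 := (@lebesgue_measure R \x @lebesgue_measure R)%E.
Implicit Types f : R3 R -> R.

Import HBNNSimple.

Lemma measurable_sin_fst : measurable_fun setT (fun p : R * R => sin p.1).
Proof.
apply: measurableT_comp; last exact: measurable_fst.
by apply: continuous_measurable_fun => x; exact: continuous_sin.
Qed.

Lemma area_indicE (A : set (R3 R)) : measurable A ->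
  (area A =
   \int[mu2]_(p in sph_dom) (\1_A (sph p) * sin p.1)%:E)%E.
Proof.
move=> mA; rewrite /area integral_mkcondr; apply: eq_integral => p _.
rewrite patchE indicE; have [Ap|Ap] := pselect (A (sph p)).
  by rewrite !mem_set// mul1r.
by rewrite !memNset// mul0r.
Qed.

(** [area] is defined on sets; increasing simple functions and monotone convergence on both sides
    carry its definition over to non-negative functions. *)
Lemma ge0_integral_area f : measurable_fun setT f -> (forall x, 0 <= f x) ->
  (\int[area]_x (f x)%:E =
   \int[mu2]_(p in sph_dom) (f (sph p) * sin p.1)%:E)%E.
Proof.
move=> mf f0; have mEf : measurable_fun setT (EFin \o f) by exact/measurable_EFinP.
have sin0 (p : R * R) : sph_dom p -> 0 <= sin p.1 by move=> [/sin_ge0_pi].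
have msin := measurable_funS measurableT (@subsetT _ sph_dom) measurable_sin_fst.
pose g := nnsfun_approx measurableT mEf.
have msph (h : R3 R -> R) : measurable_fun setT h ->
    measurable_fun sph_dom (fun p => (h (sph p) * sin p.1)%:E).
  move=> mh; apply/measurable_EFinP/measurable_funM => //.
  apply: measurable_funTS.
  by apply: measurableT_comp => //; exact: measurable_sph.
have gf x : EFin \o g ^~ x @ \oo --> (f x)%:E.
  by apply: (cvg_nnsfun_approx measurableT mEf) => // y _; rewrite lee_fin.
transitivity (limn (fun n => \int[area]_x (g n x)%:E)%E).
  rewrite -monotone_convergence//.
  - by apply: eq_integral => x _; apply/esym/cvg_lim => //; exact: gf.
  - by move=> n; exact/measurable_EFinP.
  - by move=> n x _; rewrite lee_fin.
  - by move=> x _ m n mn; rewrite lee_fin; exact/lefP/nd_nnsfun_approx.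
transitivity (limn (fun n => \int[mu2]_(p in sph_dom) (g n (sph p) * sin p.1)%:E)%E); last first.
  rewrite -monotone_convergence//.
  - apply: eq_integral => p _; apply/cvg_lim => //.
    under eq_fun do rewrite EFinM.
    by rewrite EFinM; apply: cvgeZr => //; exact: gf.
  - exact: measurable_sph_dom.
  - by move=> n; apply: msph.
  - by move=> n p sp; rewrite lee_fin mulr_ge0// sin0.
  - move=> p sp m n mn; rewrite lee_fin ler_wpM2r// ?sin0//.
    exact/lefP/nd_nnsfun_approx.
congr (limn _); apply/funext => n.
under eq_integral do rewrite fimfunE -fsumEFin//.
rewrite ge0_integral_fsum//; last 2 first.
  - by move=> y; exact/measurable_EFinP/measurable_funM.
  - by move=> y x _; rewrite nnfun_muleindic_ge0.
under [RHS]eq_integral => p _.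
  rewrite fimfunE mulr_fsuml -fsumEFin//.
  over.
rewrite ge0_integral_fsum//; last 3 first.
  - exact: measurable_sph_dom.
  - by move=> y; apply: (msph (fun x => y * \1_(g n @^-1` [set y]) x)); exact/measurable_funM.
  - move=> y p sp; rewrite EFinM mule_ge0 ?lee_fin ?sin0//.
    by have := nnfun_muleindic_ge0 (g n) y (sph p); rewrite lee_fin.
apply: eq_fsbigr => r _; rewrite integralZl_indic_nnsfun// integral_indic// setIT.
under [RHS]eq_integral do rewrite -mulrA EFinM.
(* A negative [r] is not a value of [g n], so its level set is empty and both sides vanish. *)
have [r0|r0] := leP 0 r; last first.
  rewrite preimage_nnfun0// measure0 mule0.
  rewrite integral0_eq// => p _.
  by rewrite indic0 mul0r mule0.
rewrite ge0_integralZl//.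
- by congr (_ * _)%E; apply: area_indicE.
- exact: measurable_sph_dom.
- by apply: msph; exact: measurable_indic.
- by move=> p sp; rewrite lee_fin mulr_ge0// sin0.
Qed.

Lemma S2_sph (p : R * R) : S2 (sph p).
Proof.
rewrite /S2 /sqnorm /sph /= !big_ord_recl big_ord0 /coord /=.
rewrite !exprMn addr0 addrA -mulrDr cos2Dsin2 mulr1 addrC; exact: cos2Dsin2.
Qed.

Lemma measurable_coord i : measurable_fun setT (@coord R i).
Proof.
by case: i => -[|[|[|//]]] ?; rewrite /coord /=;
  [apply: (measurableT_comp measurable_fst)|
   apply: (measurableT_comp measurable_snd)|]; try exact: measurable_fst; exact: measurable_snd.
Qed.

Lemma measurable_sqnorm : measurable_fun setT (@sqnorm R).
Proof.
by apply: measurable_sum => i; apply: measurable_funX; exact: measurable_coord.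
Qed.

Lemma measurable_S2 : measurable (@S2 R).
Proof.
rewrite /S2 (_ : [set x | _] = setT `&` sqnorm @^-1` [set 1]); last first.
  by rewrite setTI.
by apply: measurable_sqnorm => //; exact: measurable_set1.
Qed.

Lemma area_setC_S2 : area (~` @S2 R) = 0%E.
Proof.
rewrite /area (_ : _ `&` _ = set0) ?integral_set0// -subset0 => p [_] /=.
by apply; exact: S2_sph.
Qed.

Lemma ge0_integral_S2_prod f : measurable_fun setT f ->
  (forall x, S2 x -> 0 <= f x) ->
  (\int[area]_(x in S2) (f x)%:E =
   \int[mu2]_(p in sph_dom) (f (sph p) * sin p.1)%:E)%E.
Proof.
move=> mf f0.
(* The complement of the sphere has area 0, so [f] may be replaced by its absolute value, which is
   non-negative everywhere. An integrand such as 1/(1 - t x.b) has a sign on the sphere only. *)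
have mnf : measurable_fun setT (fun x => `|f x|) by exact: measurableT_comp.
transitivity (\int[mu2]_(p in sph_dom) (`|f (sph p)| * sin p.1)%:E)%E; last first.
  by apply: eq_integral => p _; rewrite ger0_norm// f0//; exact: S2_sph.
rewrite -(@ge0_integral_area (fun x => `|f x|))// [LHS]integral_mkcond.
apply: ae_eq_integral => //.
- apply/(measurable_restrict _ measurable_S2) => //.
  by rewrite setTI; exact/measurable_funTS/measurable_EFinP.
- exact/measurable_EFinP.
- exists (~` S2); split.
  + by apply: measurableC; exact: measurable_S2.
  + exact: area_setC_S2.
  + move=> x /= + S2x; apply => _.
    by rewrite patchE mem_set// ger0_norm// f0.
Qed.

Section slices.
Variable f : R3 R -> R.
Hypotheses (mf : measurable_fun setT f) (f0 : forall x, S2 x -> 0 <= f x).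

Let h (p : R * R) := (f (sph p) * sin p.1)%:E.

Let mh : measurable_fun setT (h \_ sph_dom).
Proof.
apply/(measurable_restrict _ measurable_sph_dom) => //.
rewrite setTI; apply: measurable_funTS.
apply/measurable_EFinP/measurable_funM; last exact: measurable_sin_fst.
by apply: measurableT_comp => //; exact: measurable_sph.
Qed.

Let h0 p : (0 <= (h \_ sph_dom) p)%E.
Proof.
rewrite patchE; case: ifPn => // /set_mem [+ _] => /sin_ge0_pi s0.
by rewrite lee_fin mulr_ge0// f0//; exact: S2_sph.
Qed.

Let slice (x : R) : \bar R :=
  (\int[mu]_(y in `[0%R, (2 * pi)%R]) (f (sph (x, y)) * sin x)%:E)%E.

Let sliceE : slice \_ `[0, pi] = fubini_F mu (h \_ sph_dom).
Proof.
apply/funext => x; rewrite /fubini_F patchE; case: ifPn => xpi.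
  rewrite [LHS]integral_mkcond; apply: eq_integral => y _.
  rewrite !patchE /sph_dom; case: (boolP (y \in _)) => ypi.
    by rewrite mem_set//=; split; apply/set_mem.
  by rewrite memNset//= => -[_ ?]; move/negP: ypi; apply; apply/mem_set.
apply/esym/integral0_eq => y _; rewrite patchE memNset//= => -[? _].
by move/negP: xpi; apply; apply/mem_set.
Qed.

(** The reflection of theta acts on the outer integral, whose integrand is this inner integral. *)
Lemma measurable_slice : measurable_fun setT (slice \_ `[0, pi]).
Proof. rewrite sliceE; exact: measurable_fun_fubini_tonelli_F. Qed.

Lemma ge0_integral_S2 :
  (\int[area]_(x in S2) (f x)%:E =
   \int[mu]_(x in `[0%R, pi]) \int[mu]_(y in `[0%R, (2 * pi)%R])
     (f (sph (x, y)) * sin x)%:E)%E.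
Proof.
rewrite ge0_integral_S2_prod// integral_mkcond fubini_tonelli1//.
by rewrite [RHS]integral_mkcond -/slice sliceE.
Qed.

End slices.

End area_integral.

(** * Isometries preserving the area *)

Section lebesgue_isometry.
Context {R : realType}.
Local Notation mu := (@lebesgue_measure R).
Implicit Types (g : R -> \bar R) (h : R -> R).

(** The pushforward of Lebesgue measure along [h] agrees with it on the half-open intervals, and
    these determine it. *)
Lemma lebesgue_measure_isometry h : measurable_fun setT h ->
  (forall a b, a < b -> mu (h @^-1` `]a, b]) = (b - a)%:E) ->
  forall A, measurable A -> mu A = mu (h @^-1` A).
Proof.
move=> mh hab.
pose hm : {mfun (measurableTypeR R) >-> (measurableTypeR R)} :=
  HB.pack (h : measurableTypeR R -> measurableTypeR R)
    (isMeasurableFun.Build _ _ (measurableTypeR R) (measurableTypeR R) h mh).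
move=> A mA.
rewrite (@lebesgue_measure_unique _ (pushforward mu hm))// => _ [[a b] _ <-] /=.
have [ab|ba] := ltP a b; last first.
  by rewrite set_itv_ge ?measure0//= -leNgt bnd_simp.
by rewrite [RHS]hab// lebesgue_measure_itv/= lte_fin ab.
Qed.

Lemma ge0_integral_lebesgue_isometry h g : measurable_fun setT h ->
  (forall a b, a < b -> mu (h @^-1` `]a, b]) = (b - a)%:E) ->
  measurable_fun setT g -> (forall x, 0 <= g x)%E ->
  (\int[mu]_x g (h x) = \int[mu]_x g x)%E.
Proof.
move=> mh hab mg g0.
pose hm : {mfun (measurableTypeR R) >-> (measurableTypeR R)} :=
  HB.pack (h : measurableTypeR R -> measurableTypeR R)
    (isMeasurableFun.Build _ _ (measurableTypeR R) (measurableTypeR R) h mh).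
transitivity (\int[pushforward mu hm]_x g x)%E.
  by rewrite ge0_integral_pushforward.
apply: eq_measure_integral => A mA _.
by apply/esym; exact: (@lebesgue_measure_isometry h).
Qed.

Lemma ge0_integral_translation (c : R) g :
  measurable_fun setT g -> (forall x, 0 <= g x)%E ->
  (\int[mu]_x g (x + c)%R = \int[mu]_x g x)%E.
Proof.
apply: ge0_integral_lebesgue_isometry.
  exact: measurable_funD.
move=> a b ab; rewrite (_ : _ @^-1` _ = `]a - c, b - c]%classic).
  by rewrite lebesgue_measure_itv/= lte_fin ltrD2r ab -EFinB; congr EFin; ring.
by apply/seteqP; split => x /=; rewrite !in_itv/= ltrBlDr lerBrDr.
Qed.

Lemma ge0_integral_reflection (c : R) g :
  measurable_fun setT g -> (forall x, 0 <= g x)%E ->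
  (\int[mu]_x g (c - x)%R = \int[mu]_x g x)%E.
Proof.
apply: ge0_integral_lebesgue_isometry.
  exact: measurable_funB.
move=> a b ab; rewrite (_ : _ @^-1` _ = `[c - b, c - a[%classic).
  rewrite lebesgue_measure_itv/= lte_fin ltrD2l ltrN2 ab.
  by rewrite -EFinB; congr EFin; ring.
apply/seteqP; split => x /=; rewrite !in_itv/= => /andP[? ?]; lra.
Qed.

(** A translation turns the left side into the integral over [c, T + c[. Cut at T, it leaves a piece
    [T, T + c[ that the period brings back to [0, c[. Half-open intervals make the cuts disjoint. *)
Lemma ge0_integral_periodic (T c : R) h : 0 <= c <= T ->
  measurable_fun setT h -> (forall x, 0 <= h x) ->
  (forall x, h (x + T) = h x) ->
  (\int[mu]_(x in `[0%R, T]) (h (x + c)%R)%:E =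
   \int[mu]_(x in `[0%R, T]) (h x)%:E)%E.
Proof.
move=> /andP[c0 cT] mh h0 hT.
have mE (D : set R) g : measurable_fun setT g -> measurable_fun D g.
  by move=> mg; exact: measurable_funTS.
have mEh : measurable_fun setT (EFin \o h) by exact/measurable_EFinP.
have mEhc : measurable_fun setT (fun x : R => (h (x + c))%:E).
  apply/measurable_EFinP; apply: (measurableT_comp mh).
  exact: measurable_funD.
have tr (a b d : R) : (\int[mu]_(x in `[(a + d)%R, (b + d)%R[) (h x)%:E =
    \int[mu]_(x in `[a, b[) (h (x + d)%R)%:E)%E.
  rewrite integral_mkcond [RHS]integral_mkcond -(ge0_integral_translation d).
  - apply: eq_integral => x _; rewrite !patchE.
    congr (if _ then _ else _); apply/idP/idP => /set_mem /=; rewrite in_itv/= => ?;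
      apply/mem_set; rewrite /= in_itv/=; lra.
  - by apply/(measurable_restrict _ (measurable_itv _)) => //; exact: mE.
  - by move=> x; rewrite patchE; case: ifPn => //; rewrite lee_fin.
have split_itv (a b d : R) : a <= d -> d <= b -> (\int[mu]_(x in `[a, b[) (h x)%:E =
    \int[mu]_(x in `[a, d[) (h x)%:E + \int[mu]_(x in `[d, b[) (h x)%:E)%E.
  move=> ad db; rewrite -ge0_integral_setU//.
  - congr integral; apply/seteqP; split => x /=; rewrite !in_itv/=; lra.
  - exact: mE.
  - by move=> x _; rewrite lee_fin.
  - apply/disj_setPS => x /= []; rewrite !in_itv/=; lra.
rewrite -(integral_itv_bndo_bndc (mE _ _ mEhc)).
rewrite -(integral_itv_bndo_bndc (mE _ _ mEh)).
rewrite -tr add0r (split_itv c (T + c) T)//; last by rewrite lerDl.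
rewrite [RHS](split_itv 0 T c)// addeC; congr (_ + _)%E.
rewrite -{1}(add0r T) (addrC T c) tr; apply: eq_integral => x _.
by rewrite hT.
Qed.

End lebesgue_isometry.

(** * Rotations about the third axis and the reflection in the equator *)

Section area_preserving.
Context {R : realType}.
Local Notation mu := (@lebesgue_measure R).
Implicit Types (f : R3 R -> R) (T : R3 R -> R3 R).

(** Stated for integrals of non-negative functions rather than for areas of sets: this is what
    Tonelli in the two angles yields, and it composes at once. *)
Definition area_preserving T := measurable_fun setT T /\
  forall f, measurable_fun setT f -> (forall x, 0 <= f x) ->
  (\int[area]_(x in S2) (f (T x))%:E = \int[area]_(x in S2) (f x)%:E)%E.

Lemma integral_S2_area_preserving T f : area_preserving T ->
  measurable_fun setT f -> integral_S2 (fun x => f (T x)) = integral_S2 f.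
Proof.
move=> [mT aT] mf; rewrite /integral_S2 /Rintegral; congr fine.
rewrite integralE [RHS]integralE.
have pos (g : R3 R -> R) : funepos (EFin \o g) = EFin \o (fun x => Num.max (g x) 0).
  by apply/funext => x; rewrite funeposE /= EFin_max.
have neg (g : R3 R -> R) : funeneg (EFin \o g) = EFin \o (fun x => Num.max (- g x) 0).
  by apply/funext => x; rewrite funenegE /= EFin_max.
rewrite !pos !neg; congr (_ - _)%E.
  apply: (aT (fun x => Num.max (f x) 0)).
    exact: measurable_maxr.
  by move=> x; rewrite le_max lexx orbT.
apply: (aT (fun x => Num.max (- f x) 0)).
  by apply: measurable_maxr => //; exact: measurableT_comp.
by move=> x; rewrite le_max lexx orbT.
Qed.

Lemma area_preserving_comp T1 T2 :
  area_preserving T1 -> area_preserving T2 -> area_preserving (T1 \o T2).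
Proof.
move=> [m1 a1] [m2 a2]; split; first exact: measurableT_comp.
move=> f mf f0; rewrite -(a1 f)//.
by apply: (a2 (f \o T1)) => [|x]; [exact: measurableT_comp|exact: f0].
Qed.

Lemma area_preserving_iter T n : area_preserving T -> area_preserving (iter n T).
Proof.
move=> aT; elim: n => [|n IH]; first by split => //; exact: measurable_id.
exact: (area_preserving_comp aT IH).
Qed.

Definition rotz (c : R) (x : R3 R) : R3 R :=
  (cos c * x.1.1 - sin c * x.1.2, sin c * x.1.1 + cos c * x.1.2, x.2).

Definition flipz (x : R3 R) : R3 R := (x.1.1, x.1.2, - x.2).

Let m11 : measurable_fun setT (fun x : R3 R => x.1.1).
Proof. exact: (measurable_coord 0). Qed.

Let m12 : measurable_fun setT (fun x : R3 R => x.1.2).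
Proof. exact: (measurable_coord 1). Qed.

(** In spherical coordinates the rotation is phi -> phi + c, which is absorbed by the period 2 pi of
    the inner integrand. *)
Lemma rotz_area_preserving c : 0 <= c <= 2 * pi -> area_preserving (rotz c).
Proof.
move=> c2pi.
have mrot : measurable_fun setT (rotz c).
  apply: measurable_fun_pair => /=; last exact: measurable_snd.
  apply: measurable_fun_pair => /=.
    by apply: measurable_funB; exact: measurable_funM.
  by apply: measurable_funD; exact: measurable_funM.
split=> // f mf f0.
rewrite !ge0_integral_S2//; last exact: measurableT_comp.
apply: eq_integral => x /set_mem /= x0pi.
have rotE y : rotz c (sph (x, y)) = sph (x, y + c).
  by rewrite /rotz /sph /= cosD sinD; congr (_, _, _); ring.
under eq_integral do rewrite rotE.
apply: (@ge0_integral_periodic _ (2 * pi) c (fun y => f (sph (x, y)) * sin x)).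
- by [].
- apply: measurable_funM => //.
  apply: measurableT_comp => //; apply: measurableT_comp measurable_sph _.
  exact: measurable_pair1.
- by move=> y; rewrite mulr_ge0// sin_ge0_pi.
- move=> y; congr (f _ * _).
  by rewrite /sph /= mulrDl mul1r addrA !cosDpi !sinDpi !opprK.
Qed.

(** In spherical coordinates the map is theta -> pi - theta, which leaves the density sin theta
    unchanged. *)
Lemma flipz_area_preserving : area_preserving flipz.
Proof.
have mflip : measurable_fun setT flipz.
  apply: measurable_fun_pair => /=.
    by apply: measurable_fun_pair.
  by apply: measurableT_comp => //; exact: measurable_snd.
split=> // f mf f0.
rewrite !ge0_integral_S2//; last exact: measurableT_comp.
have flipE (x y : R) : flipz (sph (x, y)) = sph (pi - x, y).
  rewrite /flipz /sph /= (_ : pi - x = - x + pi); last by ring.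
  by rewrite sinDpi cosDpi sinN cosN !opprK.
have sinE (x : R) : sin x = sin (pi - x).
  by rewrite (_ : pi - x = - x + pi) ?sinDpi ?sinN ?opprK//; ring.
pose g (x : R) : \bar R := (\int[mu]_(y in `[0%R, (2 * pi)%R]) (f (sph (x, y)) * sin x)%:E)%E.
transitivity (\int[mu]_(x in `[0%R, pi]) g (pi - x)%R)%E.
  apply: eq_integral => x _; apply: eq_integral => y _.
  by rewrite flipE {1}sinE.
rewrite integral_mkcond [RHS]integral_mkcond.
rewrite -(ge0_integral_reflection pi (g := g \_ `[0, pi])).
- apply: eq_integral => x _; rewrite !patchE.
  congr (if _ then _ else _); apply/idP/idP => /set_mem /=; rewrite in_itv/= => ?;
    apply/mem_set; rewrite /= in_itv/=; lra.
- exact: measurable_slice.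
- move=> x; rewrite patchE; case: ifPn => // /set_mem /sin_ge0_pi s0.
  by apply: integral_ge0 => y _; rewrite lee_fin mulr_ge0.
Qed.

End area_preserving.

(** * Smoothness on the punctured space *)

Section smooth_functions.
Context {R : realType}.
Implicit Types (f g : R3 R -> R) (x v : R3 R) (i j : 'I_3).

Let U : set (R3 R) := [set x | x != 0].

Lemma open_neq0 : open U.
Proof.
rewrite (_ : U = ~` [set 0]).
  apply: closed_openC; apply: accessible_closed_set1.
  by apply: hausdorff_accessible; exact: norm_hausdorff.
by apply/seteqP; split => x /= /eqP.
Qed.

Lemma near_neq0 x : x != 0 -> \forall y \near x, y != 0.
Proof. by move=> x0; apply: open_nbhs_nbhs; split => //; exact: open_neq0. Qed.

Lemma coordD i x y : coord i (x + y) = coord i x + coord i y.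
Proof. by case: i => -[|[|[]]]. Qed.

Lemma coordB i x y : coord i (x - y) = coord i x - coord i y.
Proof. by case: i => -[|[|[]]]. Qed.

Lemma coordZ i (c : R) x : coord i (c *: x) = c * coord i x.
Proof. by case: i => -[|[|[]]]. Qed.

Lemma continuous_coord i : continuous (@coord R i).
Proof.
move=> x; case: i => -[|[|k]] ik; rewrite /coord /=.
- apply: (@continuous_comp _ _ _ fst fst); exact: cvg_fst.
- apply: (@continuous_comp _ _ _ fst snd); [exact: cvg_fst|exact: cvg_snd].
- exact: cvg_snd.
Qed.

Global Instance is_derive_coord i x v : is_derive x v (coord i) (coord i v).
Proof.
have near_cst : \forall h \near 0^',
    (h^-1 *: ((coord i \o shift x) (h *: v) - coord i x) : R) = coord i v.
  near=> h; have h0 : h != 0 by near: h; exact: nbhs_dnbhs_neq.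
  by rewrite /= coordD coordZ addrK -[_ *: _]/(_ * _) mulKf.
constructor; first by apply: (is_cvg_near_cst (coord i v)).
by apply: lim_near_cst.
Unshelve. all: by end_near. Qed.

Lemma derive_line f x v :
  'D_v f x = 'D_(1 : R) (fun r : R => f (r *: v + x)) (0 : R).
Proof.
rewrite /derive; set g1 := fun h => h^-1 *: _; set g2 := fun h => h^-1 *: _.
suff -> : g1 = g2 by [].
by apply/funext => h; rewrite /g1 /g2 /= addr0 scale0r add0r [_%:A]mulr1.
Qed.

(** Only a directional derivative of [f] is at hand, so the chain rule of one real variable is
    applied along the line r -> r v + x. *)
Lemma is_derive_comp_real (h : R -> R) f x v (dh df : R) :
  is_derive (f x) 1 h dh -> is_derive x v f df ->
  is_derive x v (h \o f) (dh * df).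
Proof.
move=> hfx [fx <-].
pose phi (r : R) := f (r *: v + x).
have phi0 : phi 0 = f x by rewrite /phi scale0r add0r.
have dphi : is_derive (0 : R) (1 : R) phi ('D_v f x).
  constructor; first exact/(derivable1P _ _ _).1.
  by rewrite [RHS]derive_line.
rewrite -phi0 in hfx.
have [dhphi vhphi] := is_derive1_comp hfx dphi.
constructor; first exact/derivable1P.
by rewrite derive_line.
Qed.

(** Unlike [class_C], this asks for continuity at every order and not only at the last one.
    Directional derivability would not give continuity back, whereas the inductions for products and
    compositions must descend from order n + 1 to order n ([CkS]). *)
Fixpoint Ck (n : nat) f : Prop := (forall x, x != 0 -> {for x, continuous f}) /\
  if n is n'.+1 then forall i,
    (forall x, x != 0 -> derivable f x (std_basis i)) /\
    Ck n' ('D_(std_basis i) f)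
  else True.

Lemma Ck_continuous n f : Ck n f -> forall x, x != 0 -> {for x, continuous f}.
Proof. by case: n => [|n] []. Qed.

Lemma Ck_class_C n f : Ck n f -> class_C n U f.
Proof.
elim: n f => [f [cf _]//|n IH f [_ df] i /=].
by have [? ?] := df i; split => //; exact: IH.
Qed.

Lemma CkS n f : Ck n.+1 f -> Ck n f.
Proof.
elim: n f => [f [] //|n IH f [cf df]]; split=> // i.
by have [? ?] := df i; split => //; exact: IH.
Qed.

(** The punctured space is open, so agreement there passes to the directional derivatives of every
    order. *)
Lemma eq_Ck n f g : (forall x, x != 0 -> f x = g x) -> Ck n f -> Ck n g.
Proof.
elim: n f g => [|n IH] f g fg [cf df];
have nfg x : x != 0 -> \forall y \near x, f y = g y
  by [move=> /near_neq0; apply: filterS => y y0; rewrite fg];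
have cg x : x != 0 -> {for x, continuous g} by [
  move=> x0; suff : g @ x --> g x by []; rewrite -(fg x x0);
  apply: cvg_trans (cf x x0); apply: near_eq_cvg; exact: nfg];
split => //.
move=> i; have [dfi Dfi] := df i; split.
  move=> x x0; have [] // := near_eq_is_derive (nfg x x0) (derivableP (dfi x x0)).
apply: IH Dfi => x x0; exact/near_eq_derive/nfg.
Qed.

Lemma Ck_cst n (c : R) : Ck n (fun=> c).
Proof.
elim: n c => [|n IH] c; split => //; try by move=> x _; exact: cst_continuous.
move=> i; split; first by move=> x _; exact: derivable_cst.
apply: (eq_Ck _ (IH 0)) => x _; apply/esym; exact: derive_cst.
Qed.

Lemma Ck_coord n i : Ck n (coord i).
Proof.
case: n => [|n]; split => //; try by move=> x _; exact: continuous_coord.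
move=> j; split; first by move=> x _; exact: ex_derive.
apply: (eq_Ck _ (Ck_cst n (coord i (std_basis j)))) => x _.
by apply/esym; exact: derive_val.
Qed.

Lemma CkD n f g : Ck n f -> Ck n g -> Ck n (fun x => f x + g x).
Proof.
elim: n f g => [|n IH] f g [cf df] [cg dg]; split => //.
- by move=> x x0; apply: cvgD; [exact: cf|exact: cg].
- by move=> x x0; apply: cvgD; [exact: cf|exact: cg].
move=> i; have [dfi Dfi] := df i; have [dgi Dgi] := dg i; split.
  by move=> x x0; apply: derivableD; [exact: dfi|exact: dgi].
apply: (eq_Ck _ (IH _ _ Dfi Dgi)) => x x0.
by apply/esym/deriveD; [exact: dfi|exact: dgi].
Qed.

Lemma CkM n f g : Ck n f -> Ck n g -> Ck n (fun x => f x * g x).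
Proof.
elim: n f g => [|n IH] f g.
  by move=> [cf df] [cg dg]; split => // x x0; apply: cvgM; [exact: cf|exact: cg].
move=> Cf Cg; have [cf df] := Cf; have [cg dg] := Cg; split.
  by move=> x x0; apply: cvgM; [exact: cf|exact: cg].
move=> i; have [dfi Dfi] := df i; have [dgi Dgi] := dg i; split.
  by move=> x x0; apply: derivableM; [exact: dfi|exact: dgi].
apply: (eq_Ck _ (CkD (IH _ _ (CkS Cf) Dgi) (IH _ _ (CkS Cg) Dfi))) => x x0.
by apply/esym/deriveM; [exact: dfi|exact: dgi].
Qed.

Lemma Ck_sum n N (F : 'I_N -> R3 R -> R) : (forall k, Ck n (F k)) ->
  Ck n (fun x => \sum_(k < N) F k x).
Proof.
elim: N F => [|N IH] F CF.
  by apply: (eq_Ck _ (Ck_cst n 0)) => x _; rewrite big_ord0.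
apply: (eq_Ck _ (CkD (CF ord0) (IH (fun k => F (lift ord0 k)) _))) => [x _|k].
  by rewrite big_ord_recl.
exact: CF.
Qed.

(* Bootstrapping along [h']: the [n]-th order regularity of [h' \o f] may be
   derived from that of [h \o f], as when [h'] is a rational function of [h]. *)
Lemma Ck_comp (h h' : R -> R) (P : set R) :
  (forall y, P y -> is_derive y 1 h (h' y)) ->
  (forall n f, (forall x, x != 0 -> P (f x)) ->
     Ck n f -> Ck n (h \o f) -> Ck n (h' \o f)) ->
  forall n f, (forall x, x != 0 -> P (f x)) -> Ck n f -> Ck n (h \o f).
Proof.
move=> dh h'h n f Pf.
have ch y : P y -> {for y, continuous h}.
  by move=> /dh[dhy _]; exact/differentiable_continuous/derivable1_diffP.
have chf m : Ck m f -> forall x, x != 0 -> {for x, continuous (h \o f)}.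
  move=> Cf x x0; apply: continuous_comp; first exact: Ck_continuous Cf _ x0.
  exact/ch/Pf.
elim: n => [|n IH] Cf; first by split => //; exact: chf Cf.
split; first exact: chf Cf.
have [cf df] := Cf; move=> i; have [dfi Dfi] := df i.
have dhf x : x != 0 -> is_derive x (std_basis i) (h \o f) (h' (f x) * 'D_(std_basis i) f x).
  move=> x0; apply: is_derive_comp_real; last exact/derivableP/dfi.
  exact/dh/Pf.
split; first by move=> x x0; have [] := dhf x x0.
apply: (eq_Ck _ (CkM (h'h _ _ Pf (CkS Cf) (IH (CkS Cf))) Dfi)) => x x0 /=.
by have [_ ->] := dhf x x0.
Qed.

Lemma CkV n f : (forall x, x != 0 -> f x != 0) -> Ck n f -> Ck n (fun x => (f x)^-1).
Proof.
apply: (@Ck_comp (@GRing.inv R) (fun y => - (y^-1 * y^-1)) [set y | y != 0]).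
  move=> y /= y0; have := @is_deriveV _ id y 1 1 y0 (is_derive_id _ _).
  by rewrite -[_ *: _]/(_ * _) mulr1 -exprVn expr2.
move=> m g _ _ Cg.
apply: (eq_Ck _ (CkM (Ck_cst m (-1)) (CkM Cg Cg))) => x _ /=.
by rewrite mulN1r.
Qed.

Lemma Ck_sqrt n f : (forall x, x != 0 -> 0 < f x) -> Ck n f ->
  Ck n (fun x => Num.sqrt (f x)).
Proof.
apply: (@Ck_comp (@Num.sqrt R) (fun y => (2 * Num.sqrt y)^-1) [set y | 0 < y]).
move=> m g g0 Cg Csg; apply: CkV.
  by move=> x x0; rewrite mulf_neq0// gt_eqF// sqrtr_gt0; exact: g0.
by apply: CkM => //; exact: Ck_cst.
Qed.

Lemma Ck_ln n f : (forall x, x != 0 -> 0 < f x) -> Ck n f ->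
  Ck n (fun x => ln (f x)).
Proof.
apply: (@Ck_comp (@ln R) (@GRing.inv R) [set y | 0 < y]).
move=> m g g0 Cg _; apply: CkV => // x x0.
by rewrite gt_eqF//; exact: g0.
Qed.

End smooth_functions.

(** * The Euclidean inner product and auxiliary inequalities *)

Section dot_product.
Context {R : realType}.
Implicit Types (x y a : R3 R).

Definition dot x y : R := \sum_(i < 3) coord i x * coord i y.

Lemma dotC x y : dot x y = dot y x.
Proof. by apply: eq_bigr => i _; rewrite mulrC. Qed.

Lemma dotZr (c : R) x y : dot x (c *: y) = c * dot x y.
Proof. by rewrite /dot mulr_sumr; apply: eq_bigr => i _; rewrite coordZ mulrCA. Qed.

Lemma sqnormE x : sqnorm x = dot x x.
Proof. by apply: eq_bigr => i _; rewrite expr2. Qed.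

Lemma sqnorm_ge0 x : 0 <= sqnorm x.
Proof. by apply: sumr_ge0 => i _; rewrite sqr_ge0. Qed.

Lemma sqnormZ (c : R) x : sqnorm (c *: x) = c ^+ 2 * sqnorm x.
Proof. by rewrite /sqnorm mulr_sumr; apply: eq_bigr => i _; rewrite coordZ exprMn. Qed.

Lemma sqnorm_gt0 x : x != 0 -> 0 < sqnorm x.
Proof.
move=> x0; rewrite lt_neqAle sqnorm_ge0 andbT eq_sym; apply: contra x0.
rewrite psumr_eq0; last by move=> i _; rewrite sqr_ge0.
move=> /allP h; have c0 i : coord i x = 0.
  by apply/eqP; have := h i (mem_index_enum i); rewrite /= sqrf_eq0.
case: x c0 {h} => -[x1 x2] x3 c0; apply/eqP; congr (_, _, _).
- exact: (c0 0).
- exact: (c0 1).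
- exact: (c0 2).
Qed.

Lemma S2_normalize x : x != 0 -> S2 ((Num.sqrt (sqnorm x))^-1 *: x).
Proof.
move=> /sqnorm_gt0 x0.
by rewrite /S2 /= sqnormZ exprVn sqr_sqrtr ?(ltW x0)// mulVf// gt_eqF.
Qed.

Lemma sqnorm_sub x y : sqnorm (x - y) = sqnorm x + sqnorm y - 2 * dot x y.
Proof.
rewrite /sqnorm /dot !big_ord_recl !big_ord0 !coordB; ring.
Qed.

Lemma dot_le1 x y : S2 x -> S2 y -> dot x y <= 1.
Proof.
rewrite /S2 /= => Sx Sy; have := sqnorm_ge0 (x - y).
by rewrite sqnorm_sub Sx Sy; lra.
Qed.

Lemma dot_geN1 x y : S2 x -> S2 y -> -1 <= dot x y.
Proof.
rewrite /S2 /= => Sx Sy; have := sqnorm_ge0 (x - (-1) *: y).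
by rewrite sqnorm_sub sqnormZ dotZr Sx Sy; lra.
Qed.

Lemma coord_std_basis i j : coord i (std_basis j : R3 R) = (i == j)%:R.
Proof. by case: i => -[|[|[|//]]] ?; case: j => -[|[|[|//]]] ?. Qed.

Lemma dot_std_basis x i : dot x (std_basis i) = coord i x.
Proof.
rewrite /dot (bigD1 i)//= coord_std_basis eqxx mulr1 big1 ?addr0// => j ji.
by rewrite coord_std_basis (negbTE ji) mulr0.
Qed.

Lemma measurable_inv : measurable_fun setT (@GRing.inv R).
Proof.
(* This reduces the inverse to a real power of a non-negative number. At 0 both sides are 0, the
   inverse of 0 being 0. *)
have -> : @GRing.inv R = fun r : R => r * (r ^+ 2) `^ (-1).
  apply/funext => r; have [->|r0] := eqVneq r 0; first by rewrite invr0 mul0r.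
  by rewrite powR_inv1 ?sqr_ge0// expr2 invfM mulVKf.
apply: measurable_funM => //.
by apply: (measurableT_comp (measurable_powR _)); exact: measurable_funX.
Qed.

Lemma measurable_dot a : measurable_fun setT (dot a).
Proof.
by apply: measurable_sum => i; apply: measurable_funM => //; exact: measurable_coord.
Qed.

(** The variance of [v] under the weights [p] is non-negative. *)
Lemma jensen_sqr N (p v : 'I_N -> R) : (forall k, 0 <= p k) ->
  \sum_k p k = 1 -> (\sum_k p k * v k) ^+ 2 <= \sum_k p k * v k ^+ 2.
Proof.
move=> p0 p1; set m := \sum_k _.
have : 0 <= \sum_k p k * (v k - m) ^+ 2.
  by apply: sumr_ge0 => k _; rewrite mulr_ge0// sqr_ge0.
rewrite (eq_bigr (fun k => p k * v k ^+ 2 - (2 * m) * (p k * v k) + m ^+ 2 * p k)); last first.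
  by move=> k _; ring.
rewrite !big_split/= sumrN -!mulr_sumr -/m p1; lra.
Qed.

End dot_product.

(** * The test functions *)

Section test_function.
Context {R : realType}.
Variables (t : R) (N : nat) (a : 'I_N.+1 -> R3 R).
Hypotheses (t01 : 0 < t < 1) (Sa : forall k, S2 (a k)).
Implicit Types (x : R3 R) (k : 'I_N.+1) (i : 'I_3).

Definition gap (b x : R3 R) : R := 1 - t * dot b x.

Definition bubble (b x : R3 R) : R := (gap b x)^-1 ^+ 2.

Definition bubbles x : R := \sum_k bubble (a k) x.

Definition bubble_fun x : R := 2^-1 * ln (bubbles x).

(** The tangential gradient of - ln (1 - t x.a) on the sphere is t (a - (x.a) x) / (1 - t x.a). The
    gradient of u is the convex combination of these vectors with weights w_k / (w_1 + ... +
    w_N). *)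
Definition bubble_grad_coord i x : R := (bubbles x)^-1 *
  \sum_k bubble (a k) x *
    (t * (coord i (a k) - dot (a k) x * coord i x) / gap (a k) x).

Definition bubble_grad x : R3 R := (bubble_grad_coord 0 x,
  bubble_grad_coord 1 x, bubble_grad_coord 2 x).

Lemma coord_bubble_grad i x : coord i (bubble_grad x) = bubble_grad_coord i x.
Proof.
by case: i => -[|[|[|//]]] ?; rewrite /coord /=; congr bubble_grad_coord; exact: val_inj.
Qed.

Lemma gap_ge b x : S2 b -> S2 x -> 1 - t <= gap b x.
Proof.
case/andP: t01 => t0 t1 Sb Sx; have := dot_le1 Sb Sx; rewrite /gap => ?.
by rewrite lerD2l lerN2 ler_piMr// ltW.
Qed.

Lemma gap_gt0 b x : S2 b -> S2 x -> 0 < gap b x.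
Proof.
by case/andP: t01 => t0 t1 Sb Sx; apply: lt_le_trans (gap_ge Sb Sx); rewrite subr_gt0.
Qed.

Lemma bubble_ge0 b x : 0 <= bubble b x.
Proof. exact: sqr_ge0. Qed.

Lemma bubble_gt0 b x : S2 b -> S2 x -> 0 < bubble b x.
Proof. by move=> Sb Sx; rewrite exprn_gt0// invr_gt0; exact: gap_gt0. Qed.

Lemma bubbles_ge k x : bubble (a k) x <= bubbles x.
Proof.
rewrite /bubbles (bigD1 k)//= lerDl; apply: sumr_ge0 => j _; exact: bubble_ge0.
Qed.

Lemma bubbles_gt0 x : S2 x -> 0 < bubbles x.
Proof.
by move=> Sx; apply: lt_le_trans (bubbles_ge ord0 x); exact: bubble_gt0.
Qed.

Lemma expR_bubble_fun x : S2 x -> expR (2 * bubble_fun x) = bubbles x.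
Proof.
move=> Sx; rewrite /bubble_fun mulrA mulfV ?mul1r ?lnK//.
by rewrite posrE bubbles_gt0.
Qed.

Lemma measurable_gap b : measurable_fun setT (gap b).
Proof.
apply: measurable_funB => //; apply: measurable_funM => //; exact: measurable_dot.
Qed.

Lemma measurable_gapV b : measurable_fun setT (fun x => (gap b x)^-1).
Proof. by apply: (measurableT_comp measurable_inv); exact: measurable_gap. Qed.

Lemma measurable_bubble b : measurable_fun setT (bubble b).
Proof. by apply: measurable_funX; exact: measurable_gapV. Qed.

Lemma measurable_bubbles : measurable_fun setT bubbles.
Proof. by apply: measurable_sum => k; exact: measurable_bubble. Qed.

Lemma measurable_bubble_fun : measurable_fun setT bubble_fun.
Proof.
apply: measurable_funM => //.
by apply: measurableT_comp (@measurable_ln R) _ => //; exact: measurable_bubbles.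
Qed.

Lemma measurable_bubble_grad : measurable_fun setT bubble_grad.
Proof.
have m i : measurable_fun setT (bubble_grad_coord i).
  apply: measurable_funM.
    by apply: (measurableT_comp measurable_inv); exact: measurable_bubbles.
  apply: measurable_sum => k; apply: measurable_funM; first exact: measurable_bubble.
  apply: measurable_funM; last exact: measurable_gapV.
  apply: measurable_funM => //; apply: measurable_funB => //.
  by apply: measurable_funM; [exact: measurable_dot|exact: measurable_coord].
by do 2 apply: measurable_fun_pair => //.
Qed.

Let nrmV x : R := (Num.sqrt (sqnorm x))^-1.

Let gap_radial b x : gap b (nrmV x *: x) = 1 - t * (nrmV x * dot b x).
Proof. by rewrite /gap dotZr. Qed.

Lemma smooth_bubble_fun : smooth_S2 bubble_fun.
Proof.
move=> n; apply: Ck_class_C.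
have CnrmV : Ck n nrmV.
  apply: CkV.
    by move=> x x0; rewrite gt_eqF// sqrtr_gt0 sqnorm_gt0.
  apply: Ck_sqrt; first by move=> x; exact: sqnorm_gt0.
  by apply: Ck_sum => i; apply: CkM; exact: Ck_coord.
have Cdot b : Ck n (dot b).
  by apply: Ck_sum => i; apply: CkM; [exact: Ck_cst|exact: Ck_coord].
have Cgap b : S2 b -> Ck n (fun x => (gap b (nrmV x *: x))^-1).
  move=> Sb; apply: CkV.
    by move=> x x0; rewrite gt_eqF// gap_gt0//; exact: S2_normalize.
  apply: (eq_Ck (f := fun x => 1 + (- t) * (nrmV x * dot b x))).
    by move=> x _; rewrite gap_radial mulNr.
  apply: CkD; first exact: Ck_cst.
  by apply: CkM; [exact: Ck_cst|exact: CkM].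
apply: (eq_Ck (f := fun x => 2^-1 * ln (\sum_k
    ((gap (a k) (nrmV x *: x))^-1 * (gap (a k) (nrmV x *: x))^-1)))).
  by move=> x _; rewrite /radial_ext /bubble_fun /bubbles; congr (_ * ln _).
apply: CkM; first exact: Ck_cst.
apply: Ck_ln.
  move=> x /S2_normalize Sx; apply: lt_le_trans (bubbles_gt0 Sx) _.
  by apply: ler_sum => k _; rewrite /bubble expr2.
by apply: Ck_sum => k; apply: CkM; exact: Cgap.
Qed.

(** At a point of the sphere the derivative of 1/|y| in the direction e_i is - x_i. Through the
    normalisation of y this turns a_i into a_i - (x.a) x_i, the tangential part. *)
Lemma is_derive_bubble_fun x i : S2 x ->
  is_derive x (std_basis i) (radial_ext bubble_fun) (bubble_grad_coord i x).
Proof.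
move=> Sx; set e := std_basis i; have Sx1 : sqnorm x = 1 by [].
have nrm1 : nrmV x = 1 by rewrite /nrmV Sx1 sqrtr1 invr1.
have dsq : is_derive x e sqnorm (2 * coord i x).
  rewrite (_ : sqnorm = \sum_(j < 3) (coord j ^+ 2)); last first.
    by apply/funext => y; rewrite /sqnorm fct_sumE.
  have := @is_derive_sum _ _ _ 3 (fun j => coord j ^+ 2) x e
    (fun j => (2%:R * coord j x ^+ 1) *: coord j e) _.
  move=> /(_ (fun j => is_deriveX _ _)) H; apply: (is_derive_eq H).
  rewrite -(dot_std_basis x i) /dot mulr_sumr; apply: eq_bigr => j _.
  by rewrite -[_ *: _]/(_ * _) expr1 mulrA.
have dnrm : is_derive x e nrmV (- coord i x).
  have ds : is_derive x e (Num.sqrt \o sqnorm) (2^-1 * (2 * coord i x)).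
    apply: (is_derive_comp_real _ dsq).
    have := @is_derive1_sqrt R (sqnorm x); rewrite Sx1 sqrtr1 mulr1; exact.
  have := @is_derive_comp_real _ (@GRing.inv R) (Num.sqrt \o sqnorm) x e (- 1) _ _ ds.
  rewrite mulKf// mulN1r; apply.
  rewrite /= Sx1 sqrtr1.
  apply: (is_derive_eq (@is_deriveV _ id 1 1 1 (oner_neq0 _) (is_derive_id _ _))).
  by rewrite -[_ *: _]/(_ * _) mulr1 -exprVn invr1 expr1n.
have ddot b : is_derive x e (dot b) (coord i b).
  rewrite (_ : dot b = \sum_(j < 3) (coord j b *: (coord j : R3 R -> R))); last first.
    by apply/funext => y; rewrite /dot fct_sumE.
  have := @is_derive_sum _ _ _ 3 (fun j => coord j b *: (coord j : R3 R -> R)) x e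
    (fun j => coord j b *: coord j e)
    (fun j => is_deriveZ _ (is_derive_coord _ _ _)).
  move=> H; apply: (is_derive_eq H).
  by rewrite -(dot_std_basis b i) /dot.
have dgap b : is_derive x e (fun y => gap b (nrmV y *: y))
    (- t * (coord i b - dot b x * coord i x)).
  rewrite (_ : (fun y => _) = cst 1 + (- t) *: (nrmV * dot b)); last first.
    by apply/funext => y; rewrite gap_radial -mulNr.
  have := is_deriveD (is_derive_cst (1 : R) x e) (is_deriveZ (- t) (is_deriveM dnrm (ddot b))).
  move=> H; apply: (is_derive_eq H).
  rewrite nrm1 add0r -!/(_ * _); congr (_ * _).
  by rewrite -[_ *: _]/(_ * _) -[dot b x *: _]/(_ * _); ring.
have dbubble b : S2 b -> is_derive x e (fun y => bubble b (nrmV y *: y))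
    (2 * (bubble b x * (t * (coord i b - dot b x * coord i x) / gap b x))).
  move=> Sb; have g0 : gap b x != 0 by rewrite gt_eqF// gap_gt0.
  have dV := @is_deriveV _ id (gap b x) 1 1 g0 (is_derive_id _ _).
  have dV2 := @is_deriveX _ _ _ 2 _ _ _ dV.
  have gx : gap b (nrmV x *: x) = gap b x by rewrite nrm1 scale1r.
  have H := @is_derive_comp_real _ _ (fun y => gap b (nrmV y *: y)) x e _ _
    (eq_ind_r (fun r : R => is_derive r (1 : R) _ _) dV2 gx) (dgap b).
  apply: (is_derive_eq H); rewrite /bubble /=.
  rewrite -[_ *: _]/(_ * _) -[_ *: 1]/(_ * _); field.
  by rewrite -/(gap b x).
have dbubbles : is_derive x e (fun y => bubbles (nrmV y *: y))
    (2 * (bubbles x * bubble_grad_coord i x)).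
  rewrite (_ : (fun y => _) = \sum_k (fun y => bubble (a k) (nrmV y *: y))); last first.
    by apply/funext => y; rewrite fct_sumE.
  have := @is_derive_sum _ _ _ N.+1 (fun k y => bubble (a k) (nrmV y *: y)) x e _
    (fun k => dbubble _ (Sa k)).
  move=> H; apply: (is_derive_eq H).
  rewrite -mulr_sumr; congr (_ * _).
  by rewrite /bubble_grad_coord mulrA mulfV ?mul1r// gt_eqF// bubbles_gt0.
have bx : bubbles (nrmV x *: x) = bubbles x by rewrite nrm1 scale1r.
have dln := @is_derive_comp_real _ (@ln R) (fun y => bubbles (nrmV y *: y)) x e _ _
  (eq_ind_r (fun r : R => is_derive r (1 : R) _ _) (is_derive1_ln (bubbles_gt0 Sx)) bx) dbubbles.
apply: (is_derive_eq (is_deriveZ 2^-1 dln)).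
rewrite -[_ *: _]/(_ * _) mulrCA mulKf// mulKf// gt_eqF//; exact: bubbles_gt0.
Qed.

Lemma sqnorm_bubble_grad_le x : S2 x ->
  sqnorm (bubble_grad x) <= \sum_k 2 * t / gap (a k) x.
Proof.
move=> Sx; have W0 := bubbles_gt0 Sx.
pose v k i := t * (coord i (a k) - dot (a k) x * coord i x) / gap (a k) x.
pose p k := (bubbles x)^-1 * bubble (a k) x.
have p0 k : 0 <= p k by rewrite mulr_ge0 ?bubble_ge0// invr_ge0 ltW.
have p1 : \sum_k p k = 1 by rewrite -mulr_sumr mulVf// gt_eqF.
apply: (@le_trans _ _ (\sum_(i < 3) \sum_k p k * v k i ^+ 2)).
  apply: ler_sum => i _; rewrite coord_bubble_grad /bubble_grad_coord mulr_sumr.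
  apply: le_trans (jensen_sqr (fun k => v k i) p0 p1).
  by rewrite [X in _ <= X ^+ 2](eq_bigr _ (fun k _ => esym (mulrA _ _ _))).
rewrite exchange_big/=; apply: ler_sum => k _; rewrite -mulr_sumr.
have g0 := gap_gt0 (Sa k) Sx; have Sak := Sa k.
have s1 := dot_le1 (Sa k) Sx; have sN1 := dot_geN1 (Sa k) Sx.
case/andP: t01 => t0 t1.
have vE : \sum_(i < 3) v k i ^+ 2 = t ^+ 2 * (1 - dot (a k) x ^+ 2) / gap (a k) x ^+ 2.
  transitivity (t ^+ 2 * sqnorm (a k - dot (a k) x *: x) / gap (a k) x ^+ 2).
    rewrite /sqnorm mulr_sumr mulr_suml; apply: eq_bigr => i _.
    by rewrite /v coordB coordZ !exprMn exprVn.
  rewrite sqnorm_sub sqnormZ dotZr (Sa k : sqnorm _ = 1) (Sx : sqnorm _ = 1).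
  by congr (_ * _ / _); ring.
have v0 : 0 <= \sum_(i < 3) v k i ^+ 2 by apply: sumr_ge0 => i _; rewrite sqr_ge0.
(* Dropping the weights is harmless at leading order: close to a_k the k-th weight is nearly 1. *)
have pk1 : p k <= 1.
  by rewrite /p mulrC ler_pdivrMr// mul1r bubbles_ge.
apply: (le_trans (ler_piMl v0 pk1)); rewrite vE.
rewrite ler_pdivrMr ?exprn_gt0//.
rewrite [leRHS](_ : _ = 2 * t * gap (a k) x); last by field; rewrite gt_eqF.
rewrite -subr_ge0 /gap; set s := dot _ _.
rewrite (_ : _ - _ = t * (2 * (1 - t) + t * (1 - s) ^+ 2)); last by ring.
by have ? := mulr_ge0 (ltW t0) (sqr_ge0 (1 - s)); apply: mulr_ge0; lra.
Qed.

Lemma H1_gradient_bubble_fun : H1_gradient bubble_fun bubble_grad.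
Proof.
split.
- by apply: measurable_funTS; exact: measurable_bubble_fun.
- by apply: measurable_funTS; exact: measurable_bubble_grad.
exists (fun=> bubble_fun); split.
- by move=> _; exact: smooth_bubble_fun.
- rewrite (_ : (fun n => _) = cst 0%E); first exact: cvg_cst.
  apply/funext => n; apply: integral0_eq => x _.
  by rewrite subrr expr0n.
- rewrite (_ : (fun n => _) = cst 0%E); first exact: cvg_cst.
  apply/funext => n; apply: integral0_eq => x Sx.
  suff -> : grad_S2 bubble_fun x = bubble_grad x.
    by rewrite subrr -(scale0r (0 : R3 R)) sqnormZ expr0n mul0r.
  have gE i : 'D_(std_basis i) (radial_ext bubble_fun) x = bubble_grad_coord i x.
    by have [_ ->] := is_derive_bubble_fun i Sx.
  by rewrite /grad_S2 !gE.
Qed.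

(** With y the sum of the 1/(1 - t x.a_k), the sum of the w_k is at most y^2, so u <= ln y; then ln
    (eta y) <= eta y. The free parameter [eta] allows the logarithmically growing mean of y to enter
    with an arbitrarily small coefficient. *)
Lemma bubble_fun_le (eta : R) x : 0 < eta -> S2 x ->
  bubble_fun x <= eta * \sum_k (gap (a k) x)^-1 - ln eta.
Proof.
move=> eta0 Sx; set y := \sum_k _.
have g0 k : 0 < (gap (a k) x)^-1 by rewrite invr_gt0 gap_gt0.
have y0 : 0 < y.
  rewrite /y (bigD1 ord0)//= ltr_pwDl//; apply: sumr_ge0 => k _; exact: ltW.
have Wy : bubbles x <= y ^+ 2.
  rewrite expr2 {1}/y mulr_suml; apply: ler_sum => k _.
  rewrite /bubble expr2 ler_pM2l// /y (bigD1 k)//= lerDl.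
  by apply: sumr_ge0 => j _; exact: ltW.
rewrite lerBrDr; apply: (@le_trans _ _ (ln (eta * y))); last first.
  by apply/ltW/ln_sublinear; rewrite mulr_gt0.
rewrite lnM ?posrE// addrC lerD2l /bubble_fun.
rewrite mulrC ler_pdivrMr// mulr_natr -lnXn//.
by rewrite ler_ln ?posrE ?bubbles_gt0// exprn_gt0.
Qed.

End test_function.

(** * Mass and logarithmic integral of one bubble *)

Section bubble_integrals.
Context {R : realType}.
Local Notation mu := (@lebesgue_measure R).

Lemma FTC2 (F f : R -> R) (a b : R) : a < b ->
  (forall x, is_derive x (1 : R) F (f x)) -> continuous f ->
  (\int[mu]_(x in `[a, b]) (f x)%:E = (F b - F a)%:E)%E.
Proof.
move=> ab dF cf.
have cF : continuous F.
  by move=> x; apply/differentiable_continuous/derivable1_diffP; have [] := dF x.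
rewrite (@continuous_FTC2 _ f F)//.
- by apply: continuous_subspaceT.
- split.
  + by move=> x _; have [] := dF x.
  + exact/cvg_at_right_filter/cF.
  + exact/cvg_at_left_filter/cF.
- by move=> x _; rewrite derive1E; have [_ ->] := dF x.
Qed.

(* The Poisson kernel [(1 - b^2) / (1 + b^2 - 2 b cos x)] has the antiderivative
   [x + 2 atan (b sin x / (1 - b cos x))], which is smooth on the whole line. *)
Lemma integral_poisson_kernel (b k s : R) : -1 < b < 1 -> 0 < k ->
  (\int[mu]_(x in `[0%R, (2 * pi)%R]) ((k * (1 + b ^+ 2) - 2 * k * b * cos x)^-1 * s)%:E
   = (2 * pi * s / (k * (1 - b ^+ 2)))%:E)%E.
Proof.
move=> /andP[bN1 b1] k0.
have cosN1 x : -1 <= cos x :> R by exact: cos_geN1.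
have cos1 x : cos x <= 1 :> R by exact: cos_le1.
have den0 x : 0 < 1 - b * cos x.
  by have := cosN1 x; have := cos1 x; have [?|?] := leP 0 b; nra.
have ker0 x : 0 < 1 + b ^+ 2 - 2 * b * cos x.
  rewrite (_ : _ - _ = (1 - b * cos x) ^+ 2 + (b * sin x) ^+ 2); last first.
    by have := cos2Dsin2 x => h; rewrite exprMn -(_ : 1 - cos x ^+ 2 = sin x ^+ 2);
      [ring|lra].
  by rewrite ltr_pwDl ?sqr_ge0// exprn_gt0.
have b20 : 0 < 1 - b ^+ 2 by nra.
pose g x := b * sin x * (1 - b * cos x)^-1.
have dden x : is_derive x (1 : R) (fun y => 1 - b * cos y) (b * sin x).
  apply: (is_derive_eq (is_deriveB (is_derive_cst (1 : R) x (1 : R))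
    (is_deriveZ b (is_derive_cos x)))).
  by rewrite -[_ *: _]/(_ * _); ring.
have dg x : is_derive x (1 : R) g
    ((b * cos x - b ^+ 2) / (1 - b * cos x) ^+ 2).
  have dV := @is_deriveV _ (fun y => 1 - b * cos y) x _ _ (lt0r_neq0 (den0 x)) (dden x).
  apply: (is_derive_eq (is_deriveM (is_deriveZ b (is_derive_sin x)) dV)).
  have sE : sin x ^+ 2 = 1 - cos x ^+ 2 by have := cos2Dsin2 x; lra.
  transitivity (b * sin x * (- (1 - b * cos x) ^- 2 * (b * sin x)) +
    (1 - b * cos x)^-1 * (b * cos x) : R); first by [].
  rewrite (_ : b * cos x - b ^+ 2 = b * cos x * (1 - b * cos x) - b ^+ 2 * sin x ^+ 2).
    by field; rewrite gt_eqF.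
  by rewrite sE; ring.
pose c := s / (k * (1 - b ^+ 2)).
pose F x := c * (x + 2 * atan (g x)).
have dF x : is_derive x (1 : R) F ((k * (1 + b ^+ 2) - 2 * k * b * cos x)^-1 * s).
  have da := is_derive1_comp (is_derive1_atan (g x)) (dg x).
  apply: (is_derive_eq (is_deriveZ c (is_deriveD (is_derive_id _ _) (is_deriveZ 2 da)))).
  transitivity (c * (1 + 2 * ((1 + (g x) ^+ 2)^-1 *
    ((b * cos x - b ^+ 2) / (1 - b * cos x) ^+ 2))) : R); first by [].
  rewrite /c /g.
  have sE : sin x ^+ 2 = 1 - cos x ^+ 2 by have := cos2Dsin2 x; lra.
  have -> : 1 + (b * sin x * (1 - b * cos x)^-1) ^+ 2 =
      (1 + b ^+ 2 - 2 * b * cos x) / (1 - b * cos x) ^+ 2.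
    rewrite !exprMn sE; field; by rewrite gt_eqF.
  field.
  rewrite !gt_eqF//=.
  by rewrite (_ : _ - _ = k * (1 + b ^+ 2 - 2 * b * cos x)) ?mulr_gt0//; ring.
rewrite (FTC2 _ dF); last 2 first.
- by rewrite mulr_gt0 ?pi_gt0.
- move=> x; apply: cvgM; last exact: cvg_cst.
  apply: cvgV.
    rewrite gt_eqF// (_ : _ - _ = k * (1 + b ^+ 2 - 2 * b * cos x)) ?mulr_gt0//; ring.
  apply: cvgB; first exact: cvg_cst.
  by apply: cvgM; [exact: cvg_cst|exact: continuous_cos].
have sin2 : sin (2 * pi) = 0 :> R by rewrite mulr_natl sin2pi.
congr EFin; rewrite /F /g /c sin0 sin2 !mulr0 !mul0r atan0.
by rewrite !mulr0 !addr0 mulr0 subr0; field; rewrite !gt_eqF.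
Qed.

(* With [w = t cos x - a3] the integrand is, up to a constant factor, the
   derivative of [ln (w + sqrt (w ^ 2 + (1 - t ^ 2) a1 ^ 2))]. *)
Lemma integral_bubble_profile (t a1 a3 : R) : 0 < t < 1 -> 0 < a1 ->
  a1 ^+ 2 + a3 ^+ 2 = 1 ->
  (\int[mu]_(x in `[0%R, pi]) (2 * pi * sin x /
      Num.sqrt ((t * cos x - a3) ^+ 2 + (1 - t ^+ 2) * a1 ^+ 2))%:E
   = (2 * pi / t * ln ((1 + t) / (1 - t)))%:E)%E.
Proof.
move=> /andP[t0 t1] a10 a13; set d := (1 - t ^+ 2) * a1 ^+ 2.
have d0 : 0 < d by rewrite mulr_gt0 ?exprn_gt0//; nra.
have a3_lt1 : a3 < 1 by nra.
have a3_gtN1 : -1 < a3 by nra.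
have D0 (w : R) : 0 < w ^+ 2 + d by rewrite ltr_wpDl ?sqr_ge0.
have sq0 (w : R) : 0 < Num.sqrt (w ^+ 2 + d) by rewrite sqrtr_gt0.
have ls0 (w : R) : 0 < w + Num.sqrt (w ^+ 2 + d).
  rewrite -ltrBlDl sub0r; apply: le_lt_trans (ler_norm _) _.
  by rewrite normrN -sqrtr_sqr ltr_sqrt// ltrDl.
pose h (w : R) := ln (w + Num.sqrt (w ^+ 2 + d)).
have dh (w : R) : is_derive w (1 : R) h (Num.sqrt (w ^+ 2 + d))^-1.
  have dD : is_derive w (1 : R) (fun y => y ^+ 2 + d) (2 * w).
    apply: (is_derive_eq (is_deriveD (is_deriveX 2 (is_derive_id w (1 : R)))
      (is_derive_cst d w (1 : R)))).
    by transitivity ((2%:R * w ^+ 1) * 1 + 0 : R) => //; ring.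
  have ds := @is_derive1_comp _ _ (fun y : R => y ^+ 2 + d) w _ _
    (is_derive1_sqrt (D0 w)) dD.
  have dl := is_deriveD (is_derive_id w (1 : R)) ds.
  apply: (is_derive_eq (@is_derive1_comp _ _ (fun y : R => y + Num.sqrt (y ^+ 2 + d)) w _ _
    (is_derive1_ln (ls0 w)) dl)).
  by field; rewrite !gt_eqF.
pose F x := - (2 * pi / t) * h (t * cos x - a3).
pose f x := 2 * pi * sin x / Num.sqrt ((t * cos x - a3) ^+ 2 + d).
have dw x : is_derive x (1 : R) (fun y => t * cos y - a3) (- (t * sin x)).
  apply: (is_derive_eq (is_deriveB (is_deriveZ t (is_derive_cos x))
    (is_derive_cst a3 x (1 : R)))).
  by transitivity (t * (- sin x) - 0 : R) => //; ring.
have dF x : is_derive x (1 : R) F (f x).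
  apply: (is_derive_eq (is_deriveZ (- (2 * pi / t)) (@is_derive1_comp _ _
    (fun y => t * cos y - a3) x _ _ (dh _) (dw x)))).
  transitivity (- (2 * pi / t) * ((Num.sqrt ((t * cos x - a3) ^+ 2 + d))^-1 *
    - (t * sin x)) : R) => //.
  by rewrite /f; field; rewrite !gt_eqF.
rewrite (FTC2 _ dF) ?pi_gt0//; last first.
  move=> x; apply: cvgM.
    by apply: cvgM; [exact: cvg_cst|exact: continuous_sin].
  apply: cvgV; first by rewrite gt_eqF.
  apply: (@continuous_comp _ _ _ (fun y => (t * cos y - a3) ^+ 2 + d) Num.sqrt);
    last exact: sqrt_continuous.
  apply: cvgD; last exact: cvg_cst.
  have cw : {for x, continuous (fun y => t * cos y - a3)}.
    by apply/differentiable_continuous/derivable1_diffP; have [] := dw x.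
  exact: cvgM.
have sq1 (r w : R) : 0 <= r -> w ^+ 2 + d = r ^+ 2 -> Num.sqrt (w ^+ 2 + d) = r.
  by move=> r0 ->; rewrite sqrtr_sqr ger0_norm.
(* At the two poles the quantity under the root is a perfect square, (1 + t a3)^2 or (1 - t a3)^2.
   The factor 1 - a3 then cancels in the difference of logarithms, so that the value is the same for
   every base point. *)
have a1E : a1 ^+ 2 = 1 - a3 ^+ 2 by lra.
rewrite /F /h cospi cos0 (sq1 (1 + t * a3)); [|nra|by rewrite /d a1E; ring].
rewrite (sq1 (1 - t * a3)); [|nra|by rewrite /d a1E; ring].
congr EFin.
rewrite (_ : t * -1 - a3 + (1 + t * a3) = (1 - t) * (1 - a3)); last by ring.
rewrite (_ : t * 1 - a3 + (1 - t * a3) = (1 + t) * (1 - a3)); last by ring.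
rewrite ln_div ?posrE ?subr_gt0//; last by rewrite ltr_pwDl// ltW.
rewrite !lnM ?posrE ?subr_gt0//; last by rewrite ltr_pwDl// ltW.
by ring.
Qed.

End bubble_integrals.

(** * Integrals of a bubble centred on the meridian phi = 0 *)

Section bubble_mass.
Context {R : realType}.
Local Notation mu := (@lebesgue_measure R).
Local Notation mu2 := (@lebesgue_measure R \x @lebesgue_measure R)%E.
Variables (a1 a3 : R).
Hypotheses (a10 : 0 < a1) (a13 : a1 ^+ 2 + a3 ^+ 2 = 1).

Let b : R3 R := (a1, 0, a3).

Lemma S2_meridian : S2 (b : R3 R).
Proof.
rewrite /S2 /sqnorm /= !big_ord_recl big_ord0 /coord /=.
by rewrite expr0n /= addr0 add0r.
Qed.

Lemma dot_meridian (x y : R) :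
  dot b (sph (x, y)) = a1 * sin x * cos y + a3 * cos x.
Proof. by rewrite /dot !big_ord_recl big_ord0 /coord /=; ring. Qed.

Lemma integral_gapV (t : R) : 0 < t < 1 ->
  (\int[area]_(x in S2) ((gap t b x)^-1)%:E =
   (2 * pi / t * ln ((1 + t) / (1 - t)))%:E)%E.
Proof.
move=> t01; have /andP[t0 t1] := t01; have Sb := S2_meridian.
have g0 x : S2 x -> 0 < gap t b x by move=> Sx; exact: (gap_gt0 t01 Sb Sx).
rewrite ge0_integral_S2; last 2 first.
- exact: measurable_gapV.
- by move=> x /g0 gx; rewrite invr_ge0 ltW.
rewrite -(integral_bubble_profile t01 a10 a13).
apply: eq_integral => x /set_mem /=; rewrite in_itv/= => xpi.
have s0 : 0 <= sin x by exact: sin_ge0_pi.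
set A := 1 - t * a3 * cos x; set B := t * a1 * sin x.
have gE y : gap t b (sph (x, y)) = A - B * cos y.
  by rewrite /gap dot_meridian /A /B; ring.
(* [A] is the value of [gap] at phi = pi / 2. *)
have A0 : 0 < A.
  have : 0 < gap t b (sph (x, pi / 2)) by exact/g0/S2_sph.
  by rewrite gE cos_pihalf mulr0 subr0.
have B0 : 0 <= B by rewrite !mulr_ge0// ltW.
set D := (t * cos x - a3) ^+ 2 + (1 - t ^+ 2) * a1 ^+ 2.
have DE : D = A ^+ 2 - B ^+ 2.
  have sE : sin x ^+ 2 = 1 - cos x ^+ 2 by have := cos2Dsin2 x; lra.
  have aE : a1 ^+ 2 = 1 - a3 ^+ 2 by rewrite -a13; ring.
  by rewrite /D /A /B !exprMn sE aE; ring.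
have D0 : 0 < D.
  have ? : 0 < (1 - t ^+ 2) * a1 ^+ 2 by rewrite mulr_gt0 ?exprn_gt0//; nra.
  by rewrite ltr_wpDl ?sqr_ge0.
set s := Num.sqrt D; have sD : s ^+ 2 = D by rewrite sqr_sqrtr// ltW.
have sgt0 : 0 < s by rewrite sqrtr_gt0.
have As0 : 0 < A + s by rewrite addr_gt0.
(* These solve k (1 + c^2) = A and 2 k c = B with |c| < 1, which puts A - B cos phi into the form of
   a Poisson kernel; then k (1 - c^2) = s. *)
pose k := (A + s) / 2; pose c := B / (A + s).
have kA : k * (1 + c ^+ 2) = A.
  rewrite /k /c; have B2 : B ^+ 2 = A ^+ 2 - s ^+ 2 by rewrite sD DE; ring.
  rewrite exprMn exprVn B2; field; by rewrite gt_eqF.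
have kB : 2 * k * c = B by rewrite /k /c; field; rewrite gt_eqF.
have ks : k * (1 - c ^+ 2) = s.
  have B2 : B ^+ 2 = A ^+ 2 - s ^+ 2 by rewrite sD DE; ring.
  rewrite /k /c exprMn exprVn B2; field; by rewrite gt_eqF.
have k0 : 0 < k by rewrite divr_gt0.
have c1 : -1 < c < 1.
  have AB : B < A.
    by rewrite -ltr_sqr ?nnegrE ?(ltW A0)// -subr_gt0 -DE.
  rewrite /c ltr_pdivrMr// mul1r ltr_pdivlMr//; apply/andP; split; lra.
rewrite -ks; under eq_integral do rewrite gE -kA -kB.
by rewrite (integral_poisson_kernel _ c1 k0).
Qed.

Lemma abs_sin_le (x : R) : 0 <= x -> `|sin x| <= x.
Proof.
move=> x0; have [|c _] := @MVT_segment R (@sin R) (@cos R) 0 x x0.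
  exact/continuous_subspaceT/continuous_sin.
rewrite sin0 !subr0 => ->; rewrite normrM (ger0_norm x0) ler_piMl//.
exact: cos_max.
Qed.

(** Half angle: 1 - cos x = 2 sin(x/2)^2. *)
Lemma one_sub_cos_le (x : R) : 0 <= x -> 1 - cos x <= x ^+ 2 / 2.
Proof.
move=> x0; have x20 : 0 <= x / 2 by rewrite divr_ge0.
have := abs_sin_le x20; rewrite ler_norml => /andP[h1 h2].
rewrite {1}(_ : x = x / 2 + x / 2); last by field.
rewrite cosD; have := cos2Dsin2 (x / 2); nra.
Qed.

(** On a box of angles of side [r] with a corner at the base point, [gap] is at most 2 r^2 and sin
    theta at least a1 / 2. The integrand is thus at least a1 / (8 r^4) on a set of measure r^2. The
    condition r <= a1 / 4 keeps the box inside the domain and away from the poles. *)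
Lemma integral_bubble_ge (r : R) : 0 < r -> r <= a1 / 4 ->
  ((a1 / (8 * r ^+ 2))%:E <=
   \int[area]_(x in S2) (bubble (1 - r ^+ 2) b x)%:E)%E.
Proof.
move=> r0 ra.
have a13' := a13; have a1_le1 : a1 <= 1 by nra.
have r1 : r <= 1 / 4 by lra.
have t01 : 0 < 1 - r ^+ 2 < 1 by apply/andP; split; nra.
have a3N1 : -1 <= a3 <= 1 by apply/andP; split; nra.
pose th := acos a3.
have cth : cos th = a3 by rewrite acosK// in_itv.
have sth : sin th = a1.
  rewrite sin_acos// (_ : 1 - a3 ^+ 2 = a1 ^+ 2); last by rewrite -a13; ring.
  by rewrite sqrtr_sqr gtr0_norm.
have th0 : 0 <= th by exact: acos_ge0.
(* From a1 = sin (pi - th) <= pi - th: there is room for the box beyond [th]. *)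
have thpi : th + a1 <= pi.
  have : 0 <= pi - th by rewrite subr_ge0 acos_lepi.
  move=> /abs_sin_le; rewrite (_ : pi - th = - th + pi); last by ring.
  rewrite sinDpi sinN opprK sth gtr0_norm//; lra.
pose box : set (R * R) := `[th, th + r] `*` `[0, r].
have mbox : measurable box by apply: measurableX; exact: measurable_itv.
have pi_gt2 : 2 <= pi :> R by exact: pi_ge2.
have box_dom : box `<=` sph_dom.
  move=> [x y] [] /=; rewrite !in_itv/= => /andP[? ?] /andP[? ?].
  split => /=; rewrite in_itv/=; apply/andP; split; lra.
have box_bound p : box p -> a1 / (8 * r ^+ 4) <=
    bubble (1 - r ^+ 2) b (sph p) * sin p.1.
  case: p => x y [] /=; rewrite !in_itv/= => /andP[thx xth] /andP[y0 yr].
  pose h := x - th.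
  have h0 : 0 <= h by rewrite subr_ge0.
  have hr : h <= r by rewrite lerBlDl.
  have xE : x = th + h by rewrite /h; ring.
  have ch := one_sub_cos_le h0.
  have cy := one_sub_cos_le y0.
  have h2 : h ^+ 2 <= r ^+ 2 by rewrite ler_sqr ?nnegrE// ltW.
  have y2 : y ^+ 2 <= r ^+ 2 by rewrite ler_sqr ?nnegrE// ltW.
  have sinx : a1 / 2 <= sin x.
    rewrite xE sinD sth cth.
    have := abs_sin_le h0; rewrite ler_norml => /andP[sh1 sh2].
    have /andP[aN1 a31] := a3N1.
    have : - h <= a3 * sin h by nra.
    have : a1 * (1 - r ^+ 2 / 2) <= a1 * cos h by rewrite ler_pM2l//; lra.
    have : a1 * (1 - r ^+ 2 / 2) >= a1 * (3 / 4) by rewrite ler_pM2l//; nra.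
    lra.
  have g0 := gap_gt0 t01 S2_meridian (S2_sph (x, y)).
  have gle : gap (1 - r ^+ 2) b (sph (x, y)) <= 2 * r ^+ 2.
    have sx1 : sin x <= 1 by exact: sin_le1.
    have sx0 : 0 <= sin x by lra.
    (* 1 - x.b = (1 - cos h) + a1 sin theta (1 - cos phi), and each term is at most r^2 / 2. *)
    have d1 : 1 - dot b (sph (x, y)) <= r ^+ 2.
      rewrite dot_meridian.
      have : cos h = a1 * sin x + a3 * cos x by rewrite /h cosB cth sth; ring.
      have : a1 * sin x * (1 - cos y) <= 1 * (r ^+ 2 / 2).
        apply: ler_pM; rewrite ?mulr_ge0 ?(ltW a10)// ?subr_ge0 ?cos_le1//; last lra.
        by rewrite -[leRHS]mulr1 ler_pM// ltW.
      lra.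
    have := dot_le1 S2_meridian (S2_sph (x, y)).
    rewrite /gap; have := sqr_ge0 r; nra.
  rewrite /= /bubble (_ : a1 / (8 * r ^+ 4) = (2 * r ^+ 2)^-1 ^+ 2 * (a1 / 2)); last first.
    by field; rewrite gt_eqF.
  apply: ler_pM => //.
  - by rewrite sqr_ge0.
  - by rewrite divr_ge0// ltW.
  - have rr0 : 0 < 2 * r ^+ 2 by rewrite mulr_gt0 ?exprn_gt0.
    have le_inv : (2 * r ^+ 2)^-1 <= (gap (1 - r ^+ 2) b (sph (x, y)))^-1.
      by rewrite lef_pV2 ?posrE.
    by rewrite ler_sqr ?nnegrE// invr_ge0 ltW.
rewrite ge0_integral_S2_prod; last 2 first.
- exact: measurable_bubble.
- by move=> x _; exact: bubble_ge0.
have mint : measurable_fun sph_dom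
    (fun p : R * R => (bubble (1 - r ^+ 2) b (sph p) * sin p.1)%:E).
  apply: measurable_funTS; apply/measurable_EFinP/measurable_funM; last exact: measurable_sin_fst.
  by apply: measurableT_comp (measurable_bubble _ _) _ => //; exact: measurable_sph.
apply: (@le_trans _ _ (\int[mu2]_(p in box) (bubble (1 - r ^+ 2) b (sph p) * sin p.1)%:E)%E); last first.
  apply: ge0_subset_integral => //; first exact: measurable_sph_dom.
  by move=> p [/sin_ge0_pi s0 _]; rewrite lee_fin mulr_ge0// bubble_ge0.
apply: (@le_trans _ _ (\int[mu2]_(p in box) (a1 / (8 * r ^+ 4))%:E)%E); last first.
  apply: ge0_le_integral => //.
  - by move=> p _; rewrite lee_fin divr_ge0 ?(ltW a10)// mulr_ge0// exprn_ge0// ltW.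
  - exact: measurable_funS measurable_sph_dom box_dom mint.
have mu_box : (mu2 box = (r * r)%:E)%E.
  rewrite /box product_measure1E//=.
  rewrite !lebesgue_measure_itv/= !lte_fin ltrDl r0 -!EFinD -!EFinM.
  by congr EFin; ring.
rewrite integral_cst// [X in (_ <= _ * X)%E]mu_box -EFinM lee_fin.
rewrite le_eqVlt; apply/orP; left; apply/eqP; field; by rewrite gt_eqF.
Qed.

End bubble_mass.

(** * Integration of bounded functions on the sphere *)

Section integral_S2_theory.
Context {R : realType}.
Local Notation mu := (@lebesgue_measure R).
Implicit Types (f g : R3 R -> R).

Lemma area_S2 : area (@S2 R) = (4 * pi)%:E.
Proof.
transitivity (\int[area]_(x in @S2 R) (1%R)%:E)%E.
  by rewrite integral_cst ?mul1e//; exact: measurable_S2.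
rewrite (@ge0_integral_S2 _ (fun=> 1))//.
transitivity (\int[mu]_(x in `[0%R, pi]) (2 * pi * sin x)%:E)%E.
  apply: eq_integral => x _; rewrite integral_cst//=.
  have pi0 : (0 < 2 * pi :> R) by rewrite mulr_gt0// pi_gt0.
  rewrite lebesgue_measure_itv/= lte_fin pi0 -EFinD -EFinM.
  by congr EFin; ring.
have dF (x : R) : is_derive x (1 : R) (fun y => - (2 * pi) * cos y) (2 * pi * sin x).
  apply: (is_derive_eq (is_deriveZ (- (2 * pi)) (is_derive_cos x))).
  by transitivity (- (2 * pi) * (- sin x) : R) => //; ring.
rewrite (FTC2 _ dF) ?pi_gt0//.
  by rewrite cospi cos0; congr EFin; ring.
by move=> x; apply: cvgM; [exact: cvg_cst|exact: continuous_sin].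
Qed.

(** At a fixed t all the integrands belong to this class. It is stable under sums and products, and
    integrability follows from the finite total area. *)
Definition bounded_S2 f :=
  measurable_fun setT f /\ exists M : R, forall x, S2 x -> `|f x| <= M.

Lemma bounded_S2_integrable f : bounded_S2 f ->
  area.-integrable (@S2 R) (EFin \o f).
Proof.
move=> [mf [M fM]]; apply: measurable_bounded_integrable.
- exact: measurable_S2.
- by rewrite [ltLHS]area_S2 ltry.
- exact: measurable_funTS.
- exists M; split; first exact: num_real.
  by move=> y My x Sx; apply: le_trans (fM x Sx) _; exact: ltW.
Qed.

Lemma bounded_S2_cst (c : R) : bounded_S2 (fun=> c).
Proof. by split => //; exists `|c|. Qed.

Lemma bounded_S2D f g : bounded_S2 f -> bounded_S2 g ->
  bounded_S2 (fun x => f x + g x).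
Proof.
move=> [mf [M fM]] [mg [M' gM]]; split; first exact: measurable_funD.
exists (M + M') => x Sx; apply: le_trans (ler_normD _ _) _.
by rewrite lerD ?fM ?gM.
Qed.

Lemma bounded_S2M f g : bounded_S2 f -> bounded_S2 g ->
  bounded_S2 (fun x => f x * g x).
Proof.
move=> [mf [M fM]] [mg [M' gM]]; split; first exact: measurable_funM.
by exists (M * M') => x Sx; rewrite normrM ler_pM ?fM ?gM.
Qed.

Lemma bounded_S2_sum N (F : 'I_N -> R3 R -> R) : (forall k, bounded_S2 (F k)) ->
  bounded_S2 (fun x => \sum_k F k x).
Proof.
move=> bF; split; first by apply: measurable_sum => k; have [] := bF k.
pose M k := sval (cid (bF k).2).
exists (\sum_k M k) => x Sx; apply: le_trans (ler_norm_sum _ _ _) _.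
apply: ler_sum => k _; rewrite /M; case: cid => /= y; exact.
Qed.

Lemma coord_S2_le1 i (x : R3 R) : S2 x -> `|coord i x| <= 1.
Proof.
rewrite /S2 /= /sqnorm (bigD1 i)//= => Sx.
rewrite -(@expr_le1 _ 2)// -normrX ger0_norm ?sqr_ge0// -Sx lerDl.
by apply: sumr_ge0 => j _; rewrite sqr_ge0.
Qed.

Lemma bounded_S2_coord i : bounded_S2 (coord i).
Proof. by split; [exact: measurable_coord|exists 1 => x; exact: coord_S2_le1]. Qed.

Lemma eq_integral_S2 f g : (forall x, S2 x -> f x = g x) ->
  integral_S2 f = integral_S2 g.
Proof. by move=> fg; apply: eq_Rintegral => x /set_mem; exact: fg. Qed.

Lemma le_integral_S2 f g : bounded_S2 f -> bounded_S2 g ->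
  (forall x, S2 x -> f x <= g x) -> integral_S2 f <= integral_S2 g.
Proof.
move=> bf bg fg; apply: le_Rintegral => //.
- exact: measurable_S2.
- exact: bounded_S2_integrable.
- exact: bounded_S2_integrable.
Qed.

Lemma integral_S2D f g : bounded_S2 f -> bounded_S2 g ->
  integral_S2 (fun x => f x + g x) = integral_S2 f + integral_S2 g.
Proof.
move=> bf bg; apply: RintegralD.
- exact: measurable_S2.
- exact: bounded_S2_integrable.
- exact: bounded_S2_integrable.
Qed.

Lemma integral_S2Z (c : R) f : bounded_S2 f ->
  integral_S2 (fun x => c * f x) = c * integral_S2 f.
Proof.
move=> bf; apply: RintegralZl; [exact: measurable_S2|exact: bounded_S2_integrable].
Qed.

Lemma integral_S2_cst (c : R) : integral_S2 (fun=> c) = 4 * pi * c.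
Proof.
rewrite /integral_S2 Rintegral_cst; last exact: measurable_S2.
by rewrite [X in fine X]area_S2 mulrC.
Qed.

Lemma integral_S2_sum N (F : 'I_N -> R3 R -> R) : (forall k, bounded_S2 (F k)) ->
  integral_S2 (fun x => \sum_k F k x) = \sum_k integral_S2 (F k).
Proof.
elim: N F => [|N IH] F bF.
  under eq_integral_S2 do rewrite big_ord0.
  by rewrite integral_S2_cst mulr0 big_ord0.
rewrite big_ord_recl -IH// -integral_S2D//; last first.
  exact: bounded_S2_sum.
by apply: eq_integral_S2 => x _; rewrite big_ord_recl.
Qed.

Lemma abs_integral_S2_le f g : bounded_S2 f -> bounded_S2 g ->
  (forall x, S2 x -> `|f x| <= g x) -> `|integral_S2 f| <= integral_S2 g.
Proof.
move=> bf bg fg; rewrite ler_norml; apply/andP; split.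
  rewrite -mulN1r -integral_S2Z//; apply: le_integral_S2 => //.
    exact/bounded_S2M/bg/bounded_S2_cst.
  by move=> x /fg; rewrite ler_norml mulN1r => /andP[].
by apply: le_integral_S2 => // x /fg; rewrite ler_norml => /andP[].
Qed.

Lemma EFin_integral_S2 f : bounded_S2 f ->
  (\int[area]_(x in S2) (f x)%:E = (integral_S2 f)%:E)%E.
Proof.
move=> bf; rewrite /integral_S2 /Rintegral fineK//; apply: integrable_fin_num.
  exact: measurable_S2.
exact: bounded_S2_integrable.
Qed.

Section bounded_bubble.
Variables (t : R) (b : R3 R).
Hypotheses (t01 : 0 < t < 1) (Sb : S2 b).

Lemma bounded_S2_gapV : bounded_S2 (fun x => (gap t b x)^-1).
Proof.
case/andP: (t01) => t0 t1.
split; first exact: measurable_gapV.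
exists (1 - t)^-1 => x Sx; have g0 := gap_gt0 t01 Sb Sx.
rewrite ger0_norm; last by rewrite invr_ge0 ltW.
have ? : 0 < 1 - t by rewrite subr_gt0.
by rewrite lef_pV2 ?posrE//; exact: (gap_ge t01 Sb Sx).
Qed.

Lemma bounded_S2_bubble : bounded_S2 (bubble t b).
Proof. exact: (bounded_S2M bounded_S2_gapV bounded_S2_gapV). Qed.

End bounded_bubble.

End integral_S2_theory.

(** * The lower bound attached to an orbit *)

Section orbit_of_bubbles.
Context {R : realType}.
Variables (n : nat) (T : R3 R -> R3 R) (a1 a3 : R).
Local Notation N := (n.+1%:R : R).
Let b : R3 R := (a1, 0, a3).
Let a (k : 'I_n.+1) : R3 R := iter k T b.

Hypotheses (a10 : 0 < a1) (a13 : a1 ^+ 2 + a3 ^+ 2 = 1).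
Hypotheses (Tap : area_preserving T) (Tdot : forall x y, dot (T x) (T y) = dot x y).
(** The barycenter condition after each bubble has been moved back to [b]. It is stated under the
    integral because the sum of the iterates vanishes pointwise for the rotoreflection, but for the
    rotation keeps a third coordinate, which only integrates to 0. *)
Hypothesis Tmoment : forall (t : R) i, 0 < t < 1 ->
  integral_S2 (fun x => (\sum_(k < n.+1) coord i (iter k T x)) * bubble t b x) = 0.

Let Sb : S2 b. Proof. exact: S2_meridian. Qed.

Let dot_iter k x y : dot (iter k T x) (iter k T y) = dot x y.
Proof. by elim: k => //= k <-. Qed.

Let S2_iter k x : S2 x -> S2 (iter k T x).
Proof. by rewrite /S2 /= !sqnormE dot_iter. Qed.

Let Sa k : S2 (a k). Proof. exact: S2_iter. Qed.

Let sum_cst (c : R) : \sum_(k < n.+1) c = N * c.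
Proof. by rewrite sumr_const card_ord mulr_natl. Qed.

Lemma gap_orbit (t : R) (k : 'I_n.+1) x : gap t (a k) (iter k T x) = gap t b x.
Proof. by rewrite /gap dot_iter. Qed.

(** The change of variables by the k-th iterate of T brings the bubble at a_k back to the base
    point. *)
Lemma integral_bubble_orbit (t : R) k (f : R3 R -> R) : measurable_fun setT f ->
  integral_S2 (fun x => f x * bubble t (a k) x) =
  integral_S2 (fun x => f (iter k T x) * bubble t b x).
Proof.
move=> mf.
rewrite -(integral_S2_area_preserving (area_preserving_iter k Tap)).
  by apply: eq_integral_S2 => x _; rewrite {1}/bubble gap_orbit.
by apply: measurable_funM => //; exact: measurable_bubble.
Qed.

Lemma integral_gapV_orbit (t : R) k :
  integral_S2 (fun x => (gap t (a k) x)^-1) = integral_S2 (fun x => (gap t b x)^-1).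
Proof.
rewrite -(integral_S2_area_preserving (area_preserving_iter k Tap)).
  by apply: eq_integral_S2 => x _; rewrite gap_orbit.
exact: measurable_gapV.
Qed.

Definition orbit_moment (i j : 'I_3) : R :=
  N^-1 * (\sum_k coord i (a k) * coord j (a k)) - 3^-1 * (i == j)%:R.

(** * Membership, energy, mean and second moments at a fixed t *)

Section fixed_scale.
Variable t : R.
Hypothesis t01 : 0 < t < 1.

Let I := integral_S2 (bubble t b).
Let J := integral_S2 (fun x => (gap t b x)^-1).

Let bbub k : bounded_S2 (bubble t (a k)). Proof. exact: bounded_S2_bubble. Qed.

Let bgap k : bounded_S2 (fun x => (gap t (a k) x)^-1).
Proof. exact: bounded_S2_gapV. Qed.

Let intI k : integral_S2 (bubble t (a k)) = I.
Proof.
have := @integral_bubble_orbit t k (fun=> 1) (measurable_cst _).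
rewrite (eq_integral_S2 (g := bubble t (a k))); last by move=> x _; rewrite mul1r.
by move=> ->; apply: eq_integral_S2 => x _; rewrite mul1r.
Qed.

Let intW (f : R3 R -> R) : bounded_S2 f ->
  integral_S2 (fun x => f x * expR (2 * bubble_fun t a x)) =
  \sum_k integral_S2 (fun x => f x * bubble t (a k) x).
Proof.
move=> bf; rewrite -integral_S2_sum; last by move=> k; exact: bounded_S2M.
by apply: eq_integral_S2 => x Sx; rewrite (expR_bubble_fun t01)// mulr_sumr.
Qed.

Lemma integral_expR_orbit :
  integral_S2 (fun x => expR (2 * bubble_fun t a x)) = N * I.
Proof.
rewrite (eq_integral_S2 (g := fun x => 1 * expR (2 * bubble_fun t a x))); last first.
  by move=> x _; rewrite mul1r.
rewrite (intW (bounded_S2_cst 1)) (eq_bigr (fun=> I)); last first.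
  by move=> k _; rewrite -(intI k); apply: eq_integral_S2 => x _; rewrite mul1r.
exact: sum_cst.
Qed.

Lemma M1_orbit : M1 (bubble_fun t a).
Proof.
split; first by exists (bubble_grad t a); exact: H1_gradient_bubble_fun.
move=> i; rewrite (intW (bounded_S2_coord i)).
rewrite (eq_bigr (fun k : (ordinal n.+1) => integral_S2 (fun x => coord i (iter k T x) * bubble t b x))); last first.
  by move=> k _; apply: integral_bubble_orbit; exact: measurable_coord.
rewrite -integral_S2_sum; last first.
  move=> k; have [mT _] := area_preserving_iter k Tap.
  apply: bounded_S2M; last exact: bounded_S2_bubble.
  split; first by apply: measurableT_comp => //; exact: measurable_coord.
  by exists 1 => x Sx; apply: coord_S2_le1; exact: S2_iter.
by apply: etrans (Tmoment i t01); apply: eq_integral_S2 => x _; rewrite mulr_suml.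
Qed.

Lemma mean_sqnorm_grad_le :
  mean_S2 (fun x => sqnorm (bubble_grad t a x)) <= (2 * pi)^-1 * N * (t * J).
Proof.
rewrite /mean_S2; have pi0 := @pi_gt0 R.
apply: (@le_trans _ _ ((4 * pi)^-1 * integral_S2 (fun x => \sum_k 2 * t * (gap t (a k) x)^-1))).
  rewrite ler_pM2l ?invr_gt0 ?mulr_gt0//.
  have bS : bounded_S2 (fun x => \sum_k 2 * t * (gap t (a k) x)^-1).
    by apply: bounded_S2_sum => k; apply: bounded_S2M => //; exact: bounded_S2_cst.
  apply: le_integral_S2 => //; last by move=> x Sx; exact: sqnorm_bubble_grad_le.
  split.
    by apply: (measurableT_comp measurable_sqnorm); exact: measurable_bubble_grad.
  have [_ [M fM]] := bS; exists M => x Sx.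
  rewrite ger0_norm ?sqnorm_ge0//; apply: le_trans (fM x Sx).
  by apply: le_trans (ler_norm _); exact: sqnorm_bubble_grad_le.
rewrite integral_S2_sum; last first.
  by move=> k; apply: bounded_S2M => //; exact: bounded_S2_cst.
rewrite (eq_bigr (fun=> 2 * t * J)); last first.
  by move=> k _; rewrite integral_S2Z// integral_gapV_orbit.
rewrite sum_cst le_eqVlt; apply/orP; left; apply/eqP.
by move: pi0; move: (pi : R) => p p0; field; rewrite gt_eqF.
Qed.

Let bounded_bubble_fun : bounded_S2 (bubble_fun t a).
Proof.
have /andP[t0 t1] := t01.
have [mW [M WM]] : bounded_S2 (bubbles t a) by exact: bounded_S2_sum.
split; first exact: measurable_bubble_fun.
exists (2^-1 * (M + ln 4)) => x Sx.
have W0 := bubbles_gt0 t01 Sa Sx.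
have lnW : ln (bubbles t a x) <= M.
  apply: le_trans (ltW (ln_sublinear W0)) _.
  by apply: le_trans (WM x Sx); exact: ler_norm.
have M0 : 0 <= M by apply: le_trans (WM x Sx).
(* The logarithm also needs a bound away from 0: [gap] is at most 2 on the sphere, so a single
   bubble is at least 1/4. *)
have W4 : 4^-1 <= bubbles t a x.
  apply: le_trans (bubbles_ge t a ord0 x).
  have g0 := gap_gt0 t01 (Sa ord0) Sx.
  have g2 : gap t (a ord0) x <= 2.
    by rewrite /gap; have := dot_geN1 (Sa ord0) Sx; nra.
  have gi : 2^-1 <= (gap t (a ord0) x)^-1 by rewrite lef_pV2 ?posrE.
  rewrite /bubble; nra.
have lnW4 : - ln 4 <= ln (bubbles t a x).
  by rewrite -lnV ?posrE// ler_ln ?posrE// invr_gt0.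
have ln4 : 0 <= ln 4 :> R by rewrite ln_ge0// ler1n.
rewrite /bubble_fun normrM gtr0_norm ?invr_gt0// ler_pM2l ?invr_gt0//.
rewrite ler_norml; apply/andP; split; lra.
Qed.

Lemma mean_bubble_fun_le (eta : R) : 0 < eta ->
  mean_S2 (bubble_fun t a) <= (4 * pi)^-1 * (eta * N * J) - ln eta.
Proof.
move=> eta0; rewrite /mean_S2; have pi0 := @pi_gt0 R.
have bS : bounded_S2 (fun x => \sum_k (gap t (a k) x)^-1) by exact: bounded_S2_sum.
have bS' : bounded_S2 (fun x => eta * \sum_k (gap t (a k) x)^-1).
  exact: (bounded_S2M (bounded_S2_cst eta) bS).
apply: (@le_trans _ _ ((4 * pi)^-1 * integral_S2
    (fun x => eta * (\sum_k (gap t (a k) x)^-1) + - ln eta))).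
  rewrite ler_pM2l ?invr_gt0 ?mulr_gt0//; apply: le_integral_S2 => //.
    exact: (bounded_S2D bS' (bounded_S2_cst _)).
  by move=> x Sx; exact: bubble_fun_le.
rewrite (integral_S2D bS' (bounded_S2_cst _)) integral_S2_cst.
rewrite (integral_S2Z _ bS) integral_S2_sum//.
rewrite (eq_bigr (fun=> J)); last by move=> k _; rewrite integral_gapV_orbit.
rewrite sum_cst le_eqVlt; apply/orP; left; apply/eqP.
by move: pi0; move: (pi : R) => p p0; field; rewrite gt_eqF.
Qed.

(** On the k-th bubble x_i x_j is replaced by its value at a_k. The error is of first order in |x -
    a_k|; the inequality between means trades it for [eps] / 2 plus a multiple of |x - a_k|^2, hence
    of [gap]. As [gap] times [bubble] is 1/[gap], the second part integrates to a multiple of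
    [J]. *)
Lemma Lambda_orbit_close (eps : R) (i j : 'I_3) : 0 < eps -> 2^-1 <= t -> 0 < I ->
  `|Lambda (bubble_fun t a) i j - orbit_moment i j| <= eps / 2 + 8 / eps * (J / I).
Proof.
move=> eps0 t2 I0; have /andP[t0 t1] := t01.
have N0 : 0 < N by rewrite ltr0n.
pose d k x := (coord i x * coord j x - coord i (a k) * coord j (a k)).
have bd k : bounded_S2 (d k).
  exact: (bounded_S2D (bounded_S2M (bounded_S2_coord i) (bounded_S2_coord j))
    (bounded_S2_cst (- (coord i (a k) * coord j (a k))))).
have bij : bounded_S2 (fun x : R3 R => coord i x * coord j x - 3^-1 * (i == j)%:R).
  exact: (bounded_S2D (bounded_S2M (bounded_S2_coord i) (bounded_S2_coord j))
    (bounded_S2_cst (- (3^-1 * (i == j)%:R)))).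
have -> : Lambda (bubble_fun t a) i j - orbit_moment i j =
    (\sum_k integral_S2 (fun x => d k x * bubble t (a k) x)) / (N * I).
  rewrite /Lambda mxE integral_expR_orbit.
  rewrite (eq_integral_S2 (g := fun x => (coord i x * coord j x - 3^-1 * (i == j)%:R) *
    expR (2 * bubble_fun t a x))); last by move=> x _; rewrite mulrC.
  rewrite (intW bij).
  rewrite (eq_bigr (fun k => integral_S2 (fun x => d k x * bubble t (a k) x) +
    (coord i (a k) * coord j (a k) - 3^-1 * (i == j)%:R) * I)); last first.
    move=> k _; rewrite -(intI k) -(integral_S2Z _ (bbub k)) -integral_S2D.
    - by apply: eq_integral_S2 => x _; rewrite /d; ring.
    - exact: bounded_S2M.
    - exact: (bounded_S2M (bounded_S2_cst _) (bbub k)).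
  rewrite big_split/= -mulr_suml big_split/= sum_cst.
  rewrite /orbit_moment; field; by rewrite !gt_eqF.
rewrite normrM (ger0_norm (x := (N * I)^-1)); last by rewrite invr_ge0 mulr_ge0// ltW.
rewrite ler_pdivrMr ?mulr_gt0//.
apply: le_trans (ler_norm_sum _ _ _) _.
apply: (@le_trans _ _ (\sum_(k < n.+1) (eps / 2 * I + 8 / eps * J))); last first.
  rewrite sum_cst le_eqVlt; apply/orP; left; apply/eqP.
  by field; rewrite !gt_eqF.
apply: ler_sum => k _.
rewrite -(intI k) -[J](integral_gapV_orbit t k).
rewrite -(integral_S2Z _ (bbub k)) -(integral_S2Z _ (bgap k)) -integral_S2D; last 2 first.
- exact: (bounded_S2M (bounded_S2_cst _) (bbub k)).
- exact: (bounded_S2M (bounded_S2_cst _) (bgap k)).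
apply: abs_integral_S2_le.
- exact: bounded_S2M.
- apply: bounded_S2D.
  + exact: (bounded_S2M (bounded_S2_cst _) (bbub k)).
  + exact: (bounded_S2M (bounded_S2_cst _) (bgap k)).
move=> x Sx; have g0 := gap_gt0 t01 (Sa k) Sx.
have -> : (gap t (a k) x)^-1 = gap t (a k) x * bubble t (a k) x.
  by rewrite /bubble; field; rewrite gt_eqF.
rewrite mulrA -mulrDl normrM (ger0_norm (bubble_ge0 _ _ _)).
rewrite ler_wpM2r ?bubble_ge0//.
have xi := coord_S2_le1 i Sx; have aj := coord_S2_le1 j (Sa k).
have xj := coord_S2_le1 j Sx; have ai := coord_S2_le1 i (Sa k).
have dE : d k x = coord i x * (coord j x - coord j (a k)) +
  coord j (a k) * (coord i x - coord i (a k)) by rewrite /d; ring.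
(* AM-GM: [|y| <= eps / 4 + y^2 / eps] *)
have amgm (y : R) : `|y| <= eps / 4 + y ^+ 2 / eps.
  have : 0 <= (`|y| - eps / 2) ^+ 2 / eps by rewrite divr_ge0 ?sqr_ge0// ltW.
  rewrite (_ : _ / eps = `|y| ^+ 2 / eps - `|y| + eps / 4); last first.
    by field; rewrite gt_eqF.
  by rewrite real_normK ?num_real//; lra.
have coord_dist l : (coord l x - coord l (a k)) ^+ 2 <= 4 * gap t (a k) x.
  have : (coord l x - coord l (a k)) ^+ 2 <= sqnorm (x - a k).
    rewrite /sqnorm (bigD1 l)//= coordB lerDl.
    by apply: sumr_ge0 => m _; rewrite sqr_ge0.
  rewrite sqnorm_sub (Sx : sqnorm _ = 1) (Sa k : sqnorm _ = 1) dotC /gap.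
  by have := dot_le1 (Sa k) Sx; nra.
have cdj : (coord j x - coord j (a k)) ^+ 2 / eps <= 4 / eps * gap t (a k) x.
  by rewrite ler_pdivrMr// mulrAC divfK ?gt_eqF.
have cdi : (coord i x - coord i (a k)) ^+ 2 / eps <= 4 / eps * gap t (a k) x.
  by rewrite ler_pdivrMr// mulrAC divfK ?gt_eqF.
rewrite dE; apply: le_trans (ler_normD _ _) _; rewrite !normrM.
have hj : `|coord i x| * `|coord j x - coord j (a k)| <= `|coord j x - coord j (a k)|.
  by rewrite ler_piMl.
have hi : `|coord j (a k)| * `|coord i x - coord i (a k)| <= `|coord i x - coord i (a k)|.
  by rewrite ler_piMl.
have := amgm (coord j x - coord j (a k)); have := amgm (coord i x - coord i (a k)).
rewrite (_ : 8 / eps * _ = 4 / eps * gap t (a k) x + 4 / eps * gap t (a k) x); last by ring.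
lra.
Qed.

End fixed_scale.

(** The two rates that drive the comparison: [I] grows at least like r^-2, [J] at most like ln
    (1/r). The latter uses 1 - t = r^2 and ln (1 + t) <= t < 1. *)
Lemma integral_bubble_estimates (r : R) : 0 < r -> r <= a1 / 4 ->
  let t := 1 - r ^+ 2 in
  let I := integral_S2 (bubble t b) in
  let J := integral_S2 (fun x => (gap t b x)^-1) in
  [/\ 0 < t < 1, 2^-1 <= t, a1 / (8 * r ^+ 2) <= I,
      0 <= J & t * J <= 2 * pi * (1 - 2 * ln r)].
Proof.
move=> r0 ra t I J; have a13' := a13; have pi0 := @pi_gt0 R.
have a1_le1 : a1 <= 1 by nra.
have t01 : 0 < t < 1 by apply/andP; split; rewrite /t; nra.
have /andP[t0 t1] := t01.
have JE : J = 2 * pi / t * ln ((1 + t) / (1 - t)).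
  have := integral_gapV a10 a13 t01.
  by rewrite (EFin_integral_S2 (bounded_S2_gapV t01 Sb)) => -[].
split => //.
- by rewrite /t; nra.
- have := integral_bubble_ge a10 a13 r0 ra.
  by rewrite (EFin_integral_S2 (bounded_S2_bubble t01 Sb)) lee_fin.
- apply: Rintegral_ge0 => x Sx; rewrite invr_ge0 ltW//; exact: (gap_gt0 t01 Sb Sx).
rewrite JE mulrA mulrCA divff ?gt_eqF// mulr1 ler_pM2l ?mulr_gt0//.
have r20 : 0 < r ^+ 2 by rewrite exprn_gt0.
rewrite (_ : 1 - t = r ^+ 2); last by rewrite /t; ring.
rewrite ln_div ?posrE//; last by rewrite addr_gt0.
rewrite lnXn// -[ln r *+ 2]mulr_natl.
have : ln (1 + t) <= 1 by apply: le_trans (le_ln1Dx _) (ltW t1); lra.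
lra.
Qed.

(** Entrywise A^2 <= 2 B^2 + 2 (A - B)^2, which amounts to (A - 2 B)^2 >= 0; there are nine entries.
    The factor 2 is affordable because twice each limit value is still below its threshold. *)
Lemma frobenius_close (A B : 'M[R]_3) (eps : R) :
  (forall i j, `|A i j - B i j| <= eps) ->
  frobenius_norm A ^+ 2 <= 2 * (\sum_(i < 3) \sum_(j < 3) B i j ^+ 2) + 18 * eps ^+ 2.
Proof.
move=> AB; rewrite /frobenius_norm sqr_sqrtr; last first.
  by apply: sumr_ge0 => i _; apply: sumr_ge0 => j _; exact: sqr_ge0.
apply: (@le_trans _ _ (\sum_(i < 3) \sum_(j < 3) (2 * B i j ^+ 2 + 2 * eps ^+ 2))).
  apply: ler_sum => i _; apply: ler_sum => j _.
  have := AB i j; rewrite ler_norml => /andP[h1 h2].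
  by have := sqr_ge0 (A i j - 2 * B i j); nra.
under eq_bigr do rewrite big_split/= sumr_const card_ord -mulr_sumr.
rewrite big_split/= sumr_const card_ord -mulr_sumr -mulrnA lerD2l.
by rewrite -[leLHS]mulr_natl; lra.
Qed.

Lemma orbit_lower_bound (eps L alpha c : R) : 0 < eps -> 0 < alpha ->
  2 * (\sum_(i < 3) \sum_(j < 3) orbit_moment i j ^+ 2) + 18 * eps ^+ 2 <= L ->
  (forall (u : R3 R -> R) (G : R3 R -> R3 R),
    M1 u -> H1_gradient u G -> frobenius_norm (Lambda u) ^+ 2 <= L ->
    ln (mean_S2 (fun x => expR (2 * u x))) <=
      alpha * mean_S2 (fun x => sqnorm (G x)) + 2 * mean_S2 u + c) ->
  N^-1 <= alpha.
Proof.
move=> eps0 alpha0 hL hu; rewrite leNgt; apply/negP => alphaN.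
have pi0 := @pi_gt0 R; have N0 : 0 < N by rewrite ltr0n.
have aN1 : alpha * N < 1 by rewrite -ltr_pdivlMr// div1r.
(* The deficit 1 - alpha N is shared equally: one half, 2 eta N = kappa, pays for the mean of u, and
   the other half leaves a surplus 2 kappa l on the left of the inequality. *)
pose kappa := (1 - alpha * N) / 2.
pose eta := (1 - alpha * N) / (4 * N).
have kappa0 : 0 < kappa by rewrite divr_gt0// subr_gt0.
have eta0 : 0 < eta by rewrite divr_gt0 ?mulr_gt0// subr_gt0.
have m0 : 0 < N * a1 / (32 * pi) by rewrite divr_gt0 ?mulr_gt0.
(* All the terms that do not grow with l = ln (1/r); the contradiction is C < 2 kappa l. *)
pose C := - ln (N * a1 / (32 * pi)) + (1 - kappa) - 2 * ln eta + c.
(* The three bounds serve the mass estimate, the smallness of J / I, and C < 2 kappa l. For the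
   second one, J <= 12 pi / r <= 48 / r and I >= a1 / (8 r^2) give J / I <= 8 * 48 r / a1, and 128 *
   48 makes 8 / eps times this at most eps / 2. *)
pose r := Num.min (a1 / 4) (Num.min (eps ^+ 2 * a1 / (128 * 48)) (expR (- (C / (2 * kappa) + 1)))).
have r0 : 0 < r.
  rewrite !lt_min expR_gt0 andbT; apply/andP; split; first by rewrite divr_gt0.
  by rewrite divr_gt0 ?mulr_gt0 ?exprn_gt0.
have ra : r <= a1 / 4 by rewrite ge_min lexx.
have re : r <= eps ^+ 2 * a1 / (128 * 48) by rewrite !ge_min lexx orbT.
have rC : r <= expR (- (C / (2 * kappa) + 1)) by rewrite !ge_min lexx !orbT.
have a1_le1 : a1 <= 1 by have a13' := a13; nra.
have := integral_bubble_estimates r0 ra => /=.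
set t := 1 - r ^+ 2; set I := integral_S2 (bubble t b).
set J := integral_S2 (fun x => (gap t b x)^-1) => -[t01 t2 leI J0 tJ].
have /andP[t0 t1] := t01.
pose l := - ln r.
have lnrE : 1 - 2 * ln r = 1 + 2 * l by rewrite /l; ring.
have I0 : 0 < I.
  by apply: lt_le_trans leI; rewrite divr_gt0 ?mulr_gt0 ?exprn_gt0.
have l_le : l <= r^-1.
  by rewrite /l -lnV ?posrE//; apply/ltW/ln_sublinear; rewrite invr_gt0.
have l0 : 0 <= l by rewrite /l oppr_ge0 ln_le0//; lra.
have pi4 : pi <= 4 :> R by have := @pihalf_lt2 R; lra.
have leJ : J <= 4 * pi * (1 + 2 * l).
  rewrite -lnrE (_ : 4 * pi * _ = 2 * (2 * pi * (1 - 2 * ln r))); last by ring.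
  by apply: (@le_trans _ _ (2 * (t * J))); [nra|rewrite ler_pM2l].
have JI : 8 / eps * (J / I) <= eps / 2.
  have h1 : (1 + 2 * l) * r <= 3.
    have : l * r <= 1 by rewrite -ler_pdivlMr// div1r.
    nra.
  have h2 : J <= 48 / r.
    rewrite ler_pdivlMr//; apply: (@le_trans _ _ (4 * pi * ((1 + 2 * l) * r))).
      by rewrite mulrA ler_pM2r.
    have := mulr_ge0 (_ : 0 <= 1 + 2 * l) (ltW r0); nra.
  have h3 : J / I <= 8 * 48 * r / a1.
    rewrite ler_pdivrMr//; apply: (@le_trans _ _ (8 * 48 * r / a1 * (a1 / (8 * r ^+ 2)))).
      rewrite [leRHS](_ : _ = 48 / r)//.
      by field; rewrite !gt_eqF.
    by rewrite ler_pM2l// divr_gt0// !mulr_gt0.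
  apply: (@le_trans _ _ (8 / eps * (8 * 48 * r / a1))).
    by rewrite ler_pM2l// divr_gt0.
  apply: (@le_trans _ _ (8 / eps * (8 * 48 * (eps ^+ 2 * a1 / (128 * 48)) / a1))).
    by rewrite ler_pM2l ?divr_gt0// ler_pM2r ?invr_gt0// ler_pM2l ?mulr_gt0.
  by rewrite le_eqVlt; apply/orP; left; apply/eqP; field; rewrite !gt_eqF.
have frob : frobenius_norm (Lambda (bubble_fun t a)) ^+ 2 <= L.
  apply: le_trans hL.
  rewrite (_ : \sum_(i < 3) _ = \sum_(i < 3) \sum_(j < 3)
      ((\matrix_(i, j) orbit_moment i j) i j : R) ^+ 2); last first.
    by apply: eq_bigr => i _; apply: eq_bigr => j _; rewrite mxE.
  apply: frobenius_close => i j; rewrite [X in _ - X]mxE.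
  apply: le_trans (Lambda_orbit_close t01 i j eps0 t2 I0) _.
  by apply: (le_trans (lerD (lexx (eps / 2)) JI)); lra.
have := hu _ _ (M1_orbit t01) (H1_gradient_bubble_fun t01 Sa) frob.
apply/negP; rewrite -ltNge.
have low : 2 * l + ln (N * a1 / (32 * pi)) <=
    ln (mean_S2 (fun x => expR (2 * bubble_fun t a x))).
  rewrite /mean_S2 integral_expR_orbit//.
  have -> : 2 * l = ln (r ^- 2) by rewrite lnV ?posrE ?exprn_gt0// lnXn// /l -[ln r *+ 2]mulr_natl; ring.
  rewrite -lnM ?posrE ?invr_gt0 ?exprn_gt0// ler_ln ?posrE ?mulr_gt0 ?invr_gt0 ?exprn_gt0 ?mulr_gt0//.
  apply: (@le_trans _ _ ((4 * pi)^-1 * (N * (a1 / (8 * r ^+ 2))))).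
    rewrite le_eqVlt; apply/orP; left; apply/eqP.
    by move: pi0; move: (pi : R) => p p0; field; rewrite !gt_eqF.
  by rewrite ler_pM2l ?invr_gt0 ?mulr_gt0// ler_pM2l.
have grad : mean_S2 (fun x => sqnorm (bubble_grad t a x)) <= N * (1 + 2 * l).
  apply: le_trans (mean_sqnorm_grad_le t01) _.
  apply: (@le_trans _ _ ((2 * pi)^-1 * N * (2 * pi * (1 - 2 * ln r)))).
    by rewrite ler_pM2l// mulr_gt0// invr_gt0 mulr_gt0.
  rewrite le_eqVlt; apply/orP; left; apply/eqP; rewrite lnrE.
  by move: pi0; move: (pi : R) => p p0; field; rewrite !gt_eqF.
have mean : mean_S2 (bubble_fun t a) <= eta * N * (1 + 2 * l) - ln eta.
  apply: le_trans (mean_bubble_fun_le t01 eta0) _; rewrite lerD2r.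
  apply: (@le_trans _ _ ((4 * pi)^-1 * (eta * N * (4 * pi * (1 + 2 * l))))).
    by rewrite ler_pM2l ?invr_gt0 ?mulr_gt0// ler_pM2l// mulr_gt0.
  rewrite le_eqVlt; apply/orP; left; apply/eqP.
  by move: pi0; move: (pi : R) => p p0; field; rewrite !gt_eqF.
have agrad : alpha * mean_S2 (fun x => sqnorm (bubble_grad t a x)) <=
    alpha * N * (1 + 2 * l) by rewrite -mulrA ler_pM2l.
have etaE : alpha * N + 2 * (eta * N) = 1 - kappa.
  by rewrite /eta /kappa; field; rewrite gt_eqF.
have lC : C < 2 * kappa * l.
  have : ln r <= - (C / (2 * kappa) + 1).
    by rewrite -[leRHS]expRK ler_ln ?posrE ?expR_gt0.
  rewrite -ltr_pdivrMl ?mulr_gt0// mulrC /l; lra.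
apply: lt_le_trans low.
apply: (@le_lt_trans _ _ ((alpha * N + 2 * (eta * N)) * (1 + 2 * l) - 2 * ln eta + c)).
  by lra.
by rewrite etaE; move: lC; rewrite /C; lra.
Qed.

End orbit_of_bubbles.

(** * The triangle and the tetrahedron *)

Section concrete_orbits.
Context {R : realType}.

Lemma dot_rotz (c : R) x y : dot (rotz c x) (rotz c y) = dot x y.
Proof.
rewrite /dot !big_ord_recl !big_ord0 /coord /rotz /=.
transitivity ((cos c ^+ 2 + sin c ^+ 2) * (x.1.1 * y.1.1 + x.1.2 * y.1.2) + x.2 * y.2).
  by ring.
by rewrite cos2Dsin2; ring.
Qed.

Lemma dot_flipz (x y : R3 R) : dot (flipz x) (flipz y) = dot x y.
Proof. by rewrite /dot !big_ord_recl !big_ord0 /coord /flipz /=; ring. Qed.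

Lemma integral_flipz_odd (f : R3 R -> R) : bounded_S2 f ->
  (forall x, f (flipz x) = - f x) -> integral_S2 f = 0.
Proof.
move=> bf fodd; have [mf _] := bf.
have : integral_S2 f = - integral_S2 f.
  rewrite -mulN1r -(integral_S2Z _ bf).
  rewrite -{1}(integral_S2_area_preserving flipz_area_preserving mf).
  by apply: eq_integral_S2 => x _; rewrite fodd mulN1r.
lra.
Qed.

Let third : R := 2 * pi / 3.

(** Triple angle: the cube of c + i s is 1. Its imaginary part s (3 c^2 - s^2) vanishes while s > 0,
    which gives the squares; its real part c (c^2 - 3 s^2) = 1 fixes the sign of c. *)
Lemma cos_sin_third : cos third = - 2^-1 /\ sin third ^+ 2 = 3 / 4.
Proof.
have pi0 := @pi_gt0 R.
have s0 : 0 < sin third by apply: sin_gt0_pi; rewrite /third; apply/andP; split; lra.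
have cs := cos2Dsin2 third.
have t3 : third + third + third = pi *+ 2 by rewrite /third -mulr_natl; field.
have c3 : cos (third + third + third) = 1 by rewrite t3 cos2pi.
have s3 : sin (third + third + third) = 0 by rewrite t3 sin2pi.
move: c3 s3; rewrite !(cosD, sinD).
set c := cos third in cs *; set s := sin third in cs s0 * => c3 s3.
have /eqP : s * (3 * c ^+ 2 - s ^+ 2) = 0 by apply: etrans s3; ring.
rewrite mulf_eq0 gt_eqF//= => /eqP cs3.
have s2 : s ^+ 2 = 3 / 4 by lra.
split => //; have c2 : c ^+ 2 = 1 / 4 by lra.
have : c * (c ^+ 2 - 3 * s ^+ 2) = 1 by apply: etrans c3; ring.
rewrite s2 c2; lra.
Qed.

Let tripod := rotz third.

Lemma tripod_lower_bound (delta alpha c : R) : 0 < delta < 1 / 4 -> 0 < alpha ->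
  (forall (u : R3 R -> R) (G : R3 R -> R3 R),
    M1 u -> H1_gradient u G -> frobenius_norm (Lambda u) ^+ 2 <= 2 / 3 - delta ->
    ln (mean_S2 (fun x => expR (2 * u x))) <=
      alpha * mean_S2 (fun x => sqnorm (G x)) + 2 * mean_S2 u + c) ->
  1 / 3 <= alpha.
Proof.
move=> /andP[delta0 delta1] alpha0; rewrite div1r; have pi0 := @pi_gt0 R.
have [c3 s3] := cos_sin_third.
have s2E : sin third * sin third = 3 / 4 by rewrite -expr2.
have unit : (1 : R) ^+ 2 + 0 ^+ 2 = 1 by rewrite expr1n expr0n addr0.
(* Here N = 2 + 1. The tolerance 1/16 fits since 2 (1/6) + 18/256 < 2/3 - 1/4. *)
apply: (@orbit_lower_bound R 2 tripod 1 0 ltr01 unit _ (dot_rotz third) _ 16^-1) => //.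
- by apply: rotz_area_preserving; rewrite /third; apply/andP; split; lra.
- move=> t i t01; have Sb := S2_meridian unit.
  (* The three rotated copies of x add up to (0, 0, 3 x_3). A bubble centred on the equator is even
     under [flipz], so its product with x_3 is odd. *)
  rewrite (eq_integral_S2 (g := fun x => (i == 2 :> nat)%:R * 3 * (coord 2 x * bubble t (1, 0, 0) x))).
    rewrite integral_S2Z; last exact/(bounded_S2M (bounded_S2_coord _))/bounded_S2_bubble.
    rewrite integral_flipz_odd ?mulr0//.
      exact/(bounded_S2M (bounded_S2_coord _))/bounded_S2_bubble.
    move=> x; rewrite /bubble /gap /dot !big_ord_recl !big_ord0 /coord /flipz /=.
    by rewrite !mul0r mulNr.
  move=> x _; rewrite mulrA; congr (_ * _).
  rewrite !big_ord_recl big_ord0 /=.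
  case: i => -[|[|[|//]]] ? /=; rewrite /coord /tripod /rotz /= ?c3.
  + transitivity (x.1.1 * (3 / 4 - sin third * sin third)); first by field.
    by rewrite s2E; ring.
  + transitivity (x.1.2 * (3 / 4 - sin third * sin third)); first by field.
    by rewrite s2E; ring.
  + by ring.
- have orbit1 : tripod (1, 0, 0) = (- 2^-1, sin third, 0).
    by rewrite /= /tripod /rotz /= c3 !mulr1 !mulr0 subr0 addr0.
  have orbit2 : tripod (- 2^-1, sin third, 0) = (- 2^-1, - sin third, 0).
    rewrite /tripod /rotz /= c3; congr (_, _, _).
      by rewrite s2E; lra.
    by lra.
  have M (i j : 'I_3) : orbit_moment 2 tripod 1 0 i j =
      if i == j then (if i == 2 :> nat then - 3^-1 else 6^-1) else 0.
    rewrite /orbit_moment !big_ord_recl big_ord0 /= !orbit1 orbit2.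
    case: i => -[|[|[|//]]] ? /=; case: j => -[|[|[|//]]] ? /=; rewrite /coord /=; lra.
  rewrite !big_ord_recl !big_ord0 !M /=; lra.
Qed.

(** A rotoreflection of order 4. The vertices of a regular tetrahedron form the orbit of (sqrt
    (2/3), 0, sqrt (1/3)); the nearby base point (4/5, 0, 3/5) avoids square roots. *)
Let tetrapod (x : R3 R) := rotz (pi / 2) (flipz x).

Let tetrapodE (x : R3 R) : tetrapod x = (- x.1.2, x.1.1, - x.2).
Proof.
rewrite /tetrapod /rotz /flipz /= cos_pihalf sin_pihalf.
by congr (_, _, _); ring.
Qed.

Lemma tetrapod_lower_bound (delta alpha c : R) : 0 < delta < 1 / 12 -> 0 < alpha ->
  (forall (u : R3 R -> R) (G : R3 R -> R3 R),
    M1 u -> H1_gradient u G -> frobenius_norm (Lambda u) ^+ 2 <= 1 / 6 - delta ->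
    ln (mean_S2 (fun x => expR (2 * u x))) <=
      alpha * mean_S2 (fun x => sqnorm (G x)) + 2 * mean_S2 u + c) ->
  1 / 4 <= alpha.
Proof.
move=> /andP[delta0 delta1] alpha0; rewrite [1 / 4]div1r; have pi0 := @pi_gt0 R.
have a10 : 0 < 4 / 5 :> R by rewrite divr_gt0.
have unit : (4 / 5 : R) ^+ 2 + (3 / 5) ^+ 2 = 1 by field.
have Tap : area_preserving tetrapod.
  apply: (area_preserving_comp _ flipz_area_preserving).
  by apply: rotz_area_preserving; apply/andP; split; lra.
have Tdot x y : dot (tetrapod x) (tetrapod y) = dot x y.
  by rewrite /tetrapod dot_rotz dot_flipz.
(* Here N = 3 + 1, and 2 (2/1875) + 18/256 < 1/6 - 1/12. *)
apply: (@orbit_lower_bound R 3 tetrapod (4 / 5) (3 / 5) a10 unit Tap Tdot _ 16^-1) => //.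
(* The four iterates of x add up to 0 at every point. *)
- move=> t i t01; rewrite (eq_integral_S2 (g := fun=> 0)).
    by rewrite integral_S2_cst mulr0.
  move=> x _; rewrite !big_ord_recl big_ord0 /= !tetrapodE /=.
  by case: i => -[|[|[|//]]] ?; rewrite /coord /=; ring.
- have M (i j : 'I_3) : orbit_moment 3 tetrapod (4 / 5) (3 / 5) i j =
      if i == j then (if i == 2 :> nat then 2 / 75 else - 75^-1) else 0.
    rewrite /orbit_moment !big_ord_recl big_ord0 /= !tetrapodE /=.
    case: i => -[|[|[|//]]] ? /=; case: j => -[|[|[|//]]] ? /=; rewrite /coord /=; lra.
  rewrite !big_ord_recl !big_ord0 !M /=; lra.
Qed.

End concrete_orbits.

Unset Implicit Arguments.

Theorem proposition2p3 (R : realType) :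
  (exists2 delta1 : R, 0 < delta1 &
     forall delta : R, 0 < delta < delta1 ->
     forall alpha : R, 0 < alpha ->
     (exists c : R, forall (u : R3 R -> R) (G : R3 R -> R3 R),
        M1 u -> H1_gradient u G ->
        frobenius_norm (Lambda u) ^+ 2 <= 2 / 3 - delta ->
        ln (mean_S2 (fun x => expR (2 * u x))) <=
          alpha * mean_S2 (fun x => sqnorm (G x)) + 2 * mean_S2 u + c) ->
     1 / 3 <= alpha)
  /\
  (exists2 delta1 : R, 0 < delta1 &
     forall delta : R, 0 < delta < delta1 ->
     forall alpha : R, 0 < alpha ->
     (exists c : R, forall (u : R3 R -> R) (G : R3 R -> R3 R),
        M1 u -> H1_gradient u G ->
        frobenius_norm (Lambda u) ^+ 2 <= 1 / 6 - delta ->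
        ln (mean_S2 (fun x => expR (2 * u x))) <=
          alpha * mean_S2 (fun x => sqnorm (G x)) + 2 * mean_S2 u + c) ->
     1 / 4 <= alpha).
Proof.
split.
  exists (1 / 4); first by rewrite divr_gt0.
  by move=> delta hdelta alpha alpha0 [c]; exact: tripod_lower_bound.
exists (1 / 12); first by rewrite divr_gt0.
by move=> delta hdelta alpha alpha0 [c]; exact: tetrapod_lower_bound.
Qed.
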